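(* In the regime $\lambda_u/\lambda_2\to\infty$ (in which $p_{{\rm a},2}\to1$), the successful offloading probability becomes $$P_{\rm off}^{\infty}(\mathbf q_2)=\sum_{f=1}^{N_f}\frac{p_f\,q_{f,2}}{\mathcal C_{1,\gamma_0}+\mathcal C_{2,\gamma_0}+(\mathcal C_{3,\gamma_0}+1)\,q_{f,2}},$$ and the maximizer of $P_{\rm off}^{\infty}(\mathbf q_2)$ over all $\mathbf q_2=(q_{1,2},\dots,q_{N_f,2})$ with $\sum_{f=1}^{N_f}q_{f,2}\le N_c$ and $0\le q_{f,2}\le1$ for $f=1,\dots,N_f$ is $$q_{f,2}^*=\left[\frac{\sqrt{\mathcal C_{1,\gamma_0}+\mathcal C_{2,\gamma_0}}}{\sqrt{\nu}\,(\mathcal C_{3,\gamma_0}+1)}\sqrt{p_f}-\frac{\mathcal C_{1,\gamma_0}+\mathcal C_{2,\gamma_0}}{\mathcal C_{3,\gamma_0}+1}\right]_0^1,\qquad f=1,\dots,N_f,$$ where the Lagrange multiplier $\nu>0$ is chosen so that $\sum_{f=1}^{N_f}q_{f,2}^*=N_c$.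
   Context: $[x]_0^1=\max\{\min\{x,1\},0\}$. Parameters: $\lambda_1,\lambda_2,\lambda_u,P_1,P_2,B_1,B_2,\gamma_0>0$, $\alpha>2$, integer $M_1\ge1$, $M_2=1$; $\lambda_{12}=\lambda_1/\lambda_2$, $P_{12}=P_1/P_2$, $B_{12}=B_1/B_2$, $M_{12}=M_1/M_2$. $N_f$ is the number of files, $N_c$ is the cache capacity of each helper, a positive integer with $N_c\le N_f$, and $p_f=f^{-\delta}/\sum_{n=1}^{N_f}n^{-\delta}$ with $\delta>0$. ${}_2F_1$ is the Gauss hypergeometric function (analytically continued to the negative real axis), $\Gamma$ the Gamma function, and $$\mathcal C_{1,\gamma_0}=\lambda_{12}(P_{12}B_{12})^{2/\alpha}\,{}_2F_1\Big[-\tfrac2\alpha,M_1;1-\tfrac2\alpha;-\tfrac{\gamma_0}{M_{12}B_{12}}\Big],\quad \mathcal C_{2,\gamma_0}=\frac{\Gamma(1-\frac2\alpha)\Gamma(M_2+\frac2\alpha)}{\Gamma(M_2)}\gamma_0^{2/\alpha},$$ $$\mathcal C_{3,\gamma_0}={}_2F_1\Big[-\tfrac2\alpha,M_2;1-\tfrac2\alpha;-\gamma_0\Big]-\mathcal C_{2,\gamma_0}-1.$$ For a caching probability vector $\mathbf q_2\in[0,1]^{N_f}$ the successful offloading probability is $$P_{\rm off}(\mathbf q_2)=\sum_{f=1}^{N_f}\frac{p_fq_{f,2}}{\mathcal C_{1,\gamma_0}+\mathcal C_{2,\gamma_0}p_{{\rm a},2}+\mathcal C_{3,\gamma_0}p_{{\rm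 a},2}q_{f,2}+q_{f,2}},$$ $$p_{{\rm a},2}=1-\bigg(1+\frac{\lambda_u}{3.5\lambda_2}\sum_{f=1}^{N_f}\frac{p_fq_{f,2}}{\lambda_{12}(P_{12}B_{12})^{2/\alpha}+q_{f,2}}\bigg)^{-3.5}.$$ ''The regime $\lambda_u/\lambda_2\to\infty$'' means that $\lambda_u/\lambda_2\to\infty$ with all other parameters (including $\lambda_{12}$) fixed, and $P_{\rm off}^\infty$ is the corresponding pointwise limit of $P_{\rm off}$.
   Formalization: The remark that p_{a,2} tends to 1 is stated only for caching vectors q_2 that are not identically zero, because for q_2 = 0 one has p_{a,2} = 0 throughout; the limit of P_off is still stated for every q_2. *)

(* Defs.v *)
From HB Require Import structures.
From mathcomp Require Import all_boot all_order all_algebra.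
From mathcomp Require Import all_classical all_reals all_analysis.
Set Implicit Arguments.
Unset Strict Implicit.
Unset Printing Implicit Defensive.
Import Order.TTheory GRing.Theory Num.Theory.
Import numFieldNormedType.Exports.
Local Open Scope classical_set_scope.
Local Open Scope ring_scope.

(* Euler's integral of the second kind; meaningful for 0 < x. *)
Definition Gamma (R : realType) (x : R) : R :=
  \int[@lebesgue_measure R]_(t in `]0, +oo[) (t `^ (x - 1) * expR (- t)).

Definition pochhammer (R : realType) (a : R) (n : nat) : R :=
  \prod_(i < n) (a + i%:R).

Definition hyp2F1_coef (R : realType) (a b c : R) (n : nat) : R :=
  pochhammer a n * pochhammer b n / (pochhammer c n * n`!%:R).

Definition real_analytic_at (R : realType) (g : R -> R) (x0 : R) : Prop :=
  exists (a : R^nat) (r : R), 0 < r /\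
    forall x, `|x - x0| < r -> pseries a (x - x0) @ \oo --> g x.

(* The continuation lives on the whole ray ]-oo, 1[, which is connected and
   meets the disc of convergence, so its values there are unique. *)
Definition is_hyp2F1 (R : realType) (a b c : R) (g : R -> R) : Prop :=
  (forall z, `|z| < 1 -> pseries (hyp2F1_coef a b c) z @ \oo --> g z) /\
  (forall z, z < 1 -> real_analytic_at g z).

(* For z < 1, the value at z of the analytic continuation of the Gauss series;
   0 is a dummy value used only if no continuation exists. *)
Definition hyp2F1 (R : realType) (a b c z : R) : R :=
  xget 0 [set y | exists2 g, is_hyp2F1 a b c g & y = g z].

Definition clip01 (R : realType) (x : R) : R := Num.max (Num.min x 1) 0.

(* All parameters except the densities lambda_1, lambda_2, lambda_u, which are
   kept as separate arguments because they vary along the limiting regime. *)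
Record params (R : realType) := Params {
  P1 : R; P2 : R; B1 : R; B2 : R;
  gamma0 : R; alpha : R; delta : R;
  M1 : nat; M2 : nat }.

Definition P12 (R : realType) (S : params R) : R := P1 S / P2 S.
Definition B12 (R : realType) (S : params R) : R := B1 S / B2 S.
Definition M12 (R : realType) (S : params R) : R := (M1 S)%:R / (M2 S)%:R.

(* The file of rank f (1 <= f <= Nf) is the ordinal f - 1 : 'I_Nf. *)
Definition popularity (R : realType) (S : params R) (Nf : nat) (f : 'I_Nf) : R :=
  f.+1%:R `^ (- delta S) / \sum_(1 <= n < Nf.+1) n%:R `^ (- delta S).

Definition C1 (R : realType) (S : params R) (lam1 lam2 : R) : R :=
  lam1 / lam2 * (P12 S * B12 S) `^ (2 / alpha S) *
  hyp2F1 (- (2 / alpha S)) (M1 S)%:R (1 - 2 / alpha S)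
         (- (gamma0 S / (M12 S * B12 S))).

Definition C2 (R : realType) (S : params R) : R :=
  Gamma (1 - 2 / alpha S) * Gamma ((M2 S)%:R + 2 / alpha S) /
  Gamma ((M2 S)%:R : R) * gamma0 S `^ (2 / alpha S).

Definition C3 (R : realType) (S : params R) : R :=
  hyp2F1 (- (2 / alpha S)) (M2 S)%:R (1 - 2 / alpha S) (- gamma0 S)
  - C2 S - 1.

Definition pa2 (R : realType) (S : params R) (lam1 lam2 lamu : R)
    (Nf : nat) (q : 'I_Nf -> R) : R :=
  1 - (1 + lamu / (7 / 2 * lam2) *
       \sum_(f < Nf) (popularity S f * q f /
          (lam1 / lam2 * (P12 S * B12 S) `^ (2 / alpha S) + q f)))
      `^ (- (7 / 2)).

Definition Poff (R : realType) (S : params R) (lam1 lam2 lamu : R)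
    (Nf : nat) (q : 'I_Nf -> R) : R :=
  let pa := pa2 S lam1 lam2 lamu q in
  \sum_(f < Nf) (popularity S f * q f /
    (C1 S lam1 lam2 + C2 S * pa + C3 S * pa * q f + q f)).

Definition Poff_inf (R : realType) (S : params R) (lam1 lam2 : R)
    (Nf : nat) (q : 'I_Nf -> R) : R :=
  \sum_(f < Nf) (popularity S f * q f /
    (C1 S lam1 lam2 + C2 S + (C3 S + 1) * q f)).

Definition caching_vector (R : realType) (Nf : nat) (q : 'I_Nf -> R) : Prop :=
  forall f, 0 <= q f <= 1.

Definition feasible (R : realType) (Nf Nc : nat) (q : 'I_Nf -> R) : Prop :=
  \sum_(f < Nf) q f <= Nc%:R /\ caching_vector q.

Definition is_the_maximizer (R : realType) (T : Type) (A : set T) (F : T -> R)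
    (x : T) : Prop :=
  A x /\ forall y, A y -> y <> x -> F y < F x.

Definition qstar (R : realType) (S : params R) (lam1 lam2 nu : R) (Nf : nat)
    (f : 'I_Nf) : R :=
  let A := C1 S lam1 lam2 + C2 S in
  clip01 (Num.sqrt A / (Num.sqrt nu * (C3 S + 1)) * Num.sqrt (popularity S f)
          - A / (C3 S + 1)).

(* Main.v *)
(** Put s = 2/alpha, which lies in ]0, 1[.  Everything rests on the signs of
    A = C1 + C2 and B = C3 + 1.  Integrating Euler's integral by parts gives,
    for z < 1,
      2F1(-s, M; 1-s; z)
        = (1-z)^(-M) - M z \int_1^oo w^(s-2) (1 - z/w)^(-(M+1)) dw,
    whose right-hand side is real analytic on ]-oo, 1[; by the identity theorem
    it is the analytic continuation, and it is positive for z <= 0, so A > 0.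
    By Tonelli and the substitution x = y w / g,
      g^s Gamma(1-s) Gamma(1+s) = \int_0^oo g w^s / (g+w)^2 dw.
    The part of this integral on [1, oo[ is the integral term above for M = 1 at
    z = -g, and the part on [0, 1] is smaller than 1/(1+g) because w^s < 1 there;
    hence C2 < 2F1(-s, 1; 1-s; -g), that is B > 0.  The objective is then
    a sum of strictly concave functions p q / (A + B q), and q^* maximizes each
    summand of the Lagrangian; nu exists by the intermediate value theorem
    in the variable 1/sqrt nu. *)
Require Import Defs.
From HB Require Import structures.
From mathcomp Require Import all_boot all_order all_algebra.
From mathcomp Require Import all_classical all_reals all_analysis.
From mathcomp Require Import measurable_realfun ring lra.
Import Order.TTheory GRing.Theory Num.Theory.
Import numFieldNormedType.Exports.
Local Open Scope classical_set_scope.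
Local Open Scope ring_scope.
Set Implicit Arguments.
Unset Strict Implicit.
Unset Printing Implicit Defensive.

(** * Negative binomial series *)

(** The n-th partial sum of the binomial series of (1 - x)^(-(j+1)). *)
Definition negbin_sum (R : realType) (j n : nat) (x : R) : R :=
  \sum_(0 <= k < n) 'C(k + j, j)%:R * x ^+ k.

Lemma negbin_sum0 (R : realType) (n : nat) (x : R) :
  (1 - x) * negbin_sum 0 n x = 1 - x ^+ n.
Proof.
rewrite /negbin_sum; elim: n => [|n IH]; first by rewrite big_geq// expr0; ring.
by rewrite big_nat_recr//= mulrDr IH bin0 exprS; ring.
Qed.

(** Pascal's rule: multiplying by 1 - x lowers j by one, up to a boundary term. This drives the
    inductions on j below. *)
Lemma negbin_sumS (R : realType) (j n : nat) (x : R) :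
  (1 - x) * negbin_sum j.+1 n x
  = negbin_sum j n x - 'C(n + j, j.+1)%:R * x ^+ n.
Proof.
rewrite /negbin_sum; elim: n => [|n IH].
  by rewrite !big_geq// add0n bin_small// mul0r mulr0 subr0.
rewrite !big_nat_recr//= mulrDr IH addSn addnS binS natrD exprS; ring.
Qed.

Lemma negbin_sum_le (R : realType) (j n : nat) (x : R) :
  0 <= x < 1 -> negbin_sum j n x <= (1 - x) ^- j.+1.
Proof.
move=> /andP[x0 x1]; have x1' : 0 < 1 - x by rewrite subr_gt0.
elim: j => [|j IH].
  rewrite expr1 -[leRHS]mulr1 ler_pdivlMl// negbin_sum0.
  by rewrite gerBl exprn_ge0.
rewrite exprS invfM mulrC ler_pdivlMr// mulrC negbin_sumS.
by apply: le_trans IH; rewrite gerBl mulr_ge0// exprn_ge0.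
Qed.

(** The sequence is dominated by the terms of a nonnegative series whose partial sums are bounded by
    [negbin_sum_le], and such terms tend to 0. *)
Lemma bin_geometric_cvg0 (R : realType) (j : nat) (r : R) :
  0 <= r < 1 -> 'C(n + j, j.+1)%:R * r ^+ n @[n --> \oo] --> (0 : R).
Proof.
move=> r01; have /andP[r0 r1] := r01.
apply: (@squeeze_cvgr _ _ _ _ (fun=> 0)
  (fun n => 'C(n + j.+1, j.+1)%:R * r ^+ n)).
- near=> n; rewrite mulr_ge0 ?exprn_ge0//=.
  by rewrite ler_wpM2r ?exprn_ge0// ler_nat leq_bin2l// leq_add2l.
- exact: cvg_cst.
- apply: cvg_series_cvg_0; apply: nondecreasing_is_cvgn.
    apply/nondecreasing_seqP => n; rewrite /series/= big_nat_recr//= lerDl.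
    by rewrite mulr_ge0// exprn_ge0.
  exists ((1 - r) ^- j.+2) => _ [n _ <-].
  exact: negbin_sum_le.
Unshelve. all: by end_near. Qed.

(** Induction on j: [negbin_sumS] turns the remainder for j + 1 into (1 - x)^(-1) times the sum of
    the remainder for j and a boundary term. The bound is uniform in x, which later allows
    integration term by term. *)
Lemma negbin_remainder (R : realType) (j : nat) (r : R) : 0 <= r < 1 ->
  exists e : R^nat, e @ \oo --> (0 : R) /\
    forall n x, `|x| <= r -> `|(1 - x) ^- j.+1 - negbin_sum j n x| <= e n.
Proof.
move=> r01; have /andP[r0 r1] := r01; have r1' : 0 < 1 - r by rewrite subr_gt0.
have lower x : `|x| <= r -> 0 < 1 - x /\ 1 - r <= 1 - x.
  by move=> xr; have := ler_norm x; split; lra.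
elim: j => [|j [e [e0 He]]].
  exists (fun n => (1 - r)^-1 * r ^+ n); split.
    by apply: cvg_geometric; rewrite ger0_norm.
  move=> n x xr; have [x1 rx] := lower _ xr.
  have -> : (1 - x) ^- 1 - negbin_sum 0 n x = (1 - x)^-1 * x ^+ n.
    apply: (mulfI (lt0r_neq0 x1)).
    by rewrite mulrBr negbin_sum0 expr1 mulrA mulfV ?gt_eqF//; ring.
  rewrite normrM normrX ler_pM ?exprn_ge0//; last first.
    by apply: lerXn2r => //; rewrite nnegrE.
  by rewrite gtr0_norm ?invr_gt0// lef_pV2.
exists (fun n => (1 - r)^-1 * (e n + 'C(n + j, j.+1)%:R * r ^+ n)); split.
  rewrite -[X in _ --> X](mulr0 (1 - r)^-1); apply: cvgMl_tmp.
  by rewrite -[X in _ --> X](addr0 0); apply: cvgD => //; exact: bin_geometric_cvg0.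
move=> n x xr; have [x1 rx] := lower _ xr.
have -> : (1 - x) ^- j.+2 - negbin_sum j.+1 n x
    = (1 - x)^-1 * (((1 - x) ^- j.+1 - negbin_sum j n x)
                    + 'C(n + j, j.+1)%:R * x ^+ n).
  apply: (mulfI (lt0r_neq0 x1)).
  rewrite mulrBr negbin_sumS [(1 - x) ^+ j.+2]exprS invfM !mulrA mulfV ?gt_eqF//.
  by ring.
rewrite normrM ler_pM//.
  by rewrite gtr0_norm ?invr_gt0// lef_pV2.
rewrite (le_trans (ler_normD _ _))// lerD ?He// normrM normrX.
rewrite normr_nat ler_wpM2l//; apply: lerXn2r => //; rewrite nnegrE//.
Qed.

Lemma one_sub_mul_gt0 (R : realType) (z t : R) :
  z < 1 -> 0 <= t <= 1 -> 0 < 1 - z * t.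
Proof.
move=> z1 /andP[t0 t1]; have [z0|z0] := leP z 0.
  by rewrite ltr_pwDl// oppr_ge0 mulr_le0_ge0.
rewrite subr_gt0 (le_lt_trans _ z1)// ler_piMr// ltW//.
Qed.

(** An affine function of t on [0, 1] is at least the smaller of its endpoint values. *)
Lemma one_sub_mul_ge (R : realType) (z t : R) :
  0 <= t <= 1 -> Num.min 1 (1 - z) <= 1 - z * t.
Proof.
move=> /andP[t0 t1]; have [z0|z0] := leP z 0.
  by rewrite ge_min lerBrDr gerDl mulr_le0_ge0.
by rewrite ge_min [X in _ || X]lerB ?orbT// ler_piMr// ltW.
Qed.

(** Factor 1 - z t = u (1 - x) with u = 1 - z0 t and x = (z - z0) t / u; then |x| <= r because t (1
    - z0) <= u. The bound is uniform in t as well as in z. *)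
Lemma negbin_expansion (R : realType) (j : nat) (z0 r : R) :
  z0 < 1 -> 0 <= r < 1 ->
  exists e : R^nat, e @ \oo --> (0 : R) /\
    forall n z t, 0 <= t <= 1 -> `|z - z0| <= r * (1 - z0) ->
    `|(1 - z * t) ^- j.+1 -
      \sum_(0 <= k < n) ('C(k + j, j)%:R * (t ^+ k * (1 - z0 * t) ^- (k + j.+1))
                         * (z - z0) ^+ k)| <= e n.
Proof.
move=> z01 r01; have [e [e0 He]] := negbin_remainder j r01.
pose m : R := Num.min 1 (1 - z0).
have m0 : 0 < m by rewrite lt_min ltr01 subr_gt0.
exists (fun n => m ^- j.+1 * e n); split.
  by rewrite -[X in _ --> X](mulr0 (m ^- j.+1)); exact: cvgMl_tmp.
move=> n z t t01 zr; have /andP[t0 t1] := t01.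
have u0 : 0 < 1 - z0 * t by exact: one_sub_mul_gt0.
set u := 1 - z0 * t in u0 *.
pose x := (z - z0) * t / u.
have -> : 1 - z * t = u * (1 - x).
  by rewrite /x mulrBr mulr1 [u * (_ / _)]mulrC divfK ?gt_eqF// /u; ring.
have -> : \sum_(0 <= k < n) ('C(k + j, j)%:R * (t ^+ k * u ^- (k + j.+1))
    * (z - z0) ^+ k) = u ^- j.+1 * negbin_sum j n x.
  rewrite /negbin_sum mulr_sumr; apply: eq_bigr => k _.
  by rewrite /x !exprMn exprD invfM exprVn; ring.
rewrite exprMn invfM -mulrBr normrM ler_pM//.
  rewrite ger0_norm; last by rewrite invr_ge0 exprn_ge0 ?ltW.
  rewrite lef_pV2 ?posrE ?exprn_gt0//.
  by apply: lerXn2r; [rewrite nnegrE ltW|rewrite nnegrE ltW|exact: one_sub_mul_ge].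
apply: He; rewrite /x normrM normrM normfV (gtr0_norm u0) (ger0_norm t0).
rewrite ler_pdivrMr// (le_trans (ler_wpM2r t0 zr))// -mulrA ler_wpM2l//.
  by case/andP: r01.
by rewrite mulrBl mul1r /u lerD2r.
Qed.

(** * Stieltjes-type integrals and their power series *)

Lemma integrableM_bounded d (T : measurableType d) (R : realType)
    (mu : {measure set T -> \bar R}) (D : set T) (f h : T -> R) (C : R) :
  measurable D -> mu.-integrable D (EFin \o f) -> measurable_fun D h ->
  (forall x, D x -> `|h x| <= C) ->
  mu.-integrable D (EFin \o (fun x => f x * h x)).
Proof.
move=> mD fi mh hC.
apply: (@integrableMl _ _ _ mu D mD (EFin \o f) h) => //.
exists C; split; first by rewrite num_real.
by move=> M CM x Dx /=; rewrite (le_trans (hC _ Dx))// ltW.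
Qed.

(** A generalized Stieltjes transform of the weight f. For integrable f and measurable [tau] with
    values in [0, 1], the integrand is integrable for every z < 1. *)
Definition stieltjes d (T : measurableType d) (R : realType)
    (mu : {measure set T -> \bar R}) (D : set T) (f tau : T -> R) (m : nat)
    (z : R) : R :=
  \int[mu]_(x in D) (f x * (1 - z * tau x) ^- m).

Lemma integrable_stieltjes d (T : measurableType d) (R : realType)
    (mu : {measure set T -> \bar R}) (D : set T) (f tau : T -> R) (k m : nat)
    (y : R) :
  measurable D -> mu.-integrable D (EFin \o f) -> measurable_fun D tau ->
  (forall x, D x -> 0 <= tau x <= 1) -> y < 1 ->
  mu.-integrable D
    (EFin \o (fun x => f x * (tau x ^+ k * (1 - y * tau x) ^- m))).
Proof.
move=> mD fi mtau tau01 y1.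
have mK : measurable_fun D (fun x => (1 - y * tau x) ^- m).
  apply: (eq_measurable_fun (fun x => (1 - y * tau x) `^ (- m%:R))).
    move=> x; rewrite inE => Dx; rewrite powR_invn// ltW//.
    by apply: one_sub_mul_gt0 => //; exact: tau01.
  apply: (@measurableT_comp _ _ _ _ _ _ (fun a : R => a `^ (- m%:R)) D
    (fun x => 1 - y * tau x)); first exact: measurable_powR.
  apply: measurable_funB; first exact: measurable_cst.
  by apply: measurable_funM => //; exact: measurable_cst.
apply: (integrableM_bounded (C := (Num.min 1 (1 - y)) ^- m)) => //.
  by apply: measurable_funM => //; exact: measurable_funX.
move=> x Dx; have y0 := one_sub_mul_gt0 y1 (tau01 _ Dx).
have /andP[t0 t1] := tau01 _ Dx.
rewrite normrM -[leRHS]mul1r ler_pM//.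
  by rewrite normrX ger0_norm// exprn_ile1.
rewrite ger0_norm; last by rewrite invr_ge0 exprn_ge0 ?ltW.
have m0 : 0 < Num.min 1 (1 - y) by rewrite lt_min ltr01 subr_gt0.
rewrite lef_pV2 ?posrE ?exprn_gt0//.
by apply: lerXn2r; [rewrite nnegrE ltW|rewrite nnegrE ltW|exact/one_sub_mul_ge/tau01].
Qed.

(** Expand the kernel at z0 and integrate term by term: the error is at most [e n] times the
    integral of f, because [negbin_expansion] is uniform in the value of [tau]. *)
Lemma stieltjes_pseries d (T : measurableType d) (R : realType)
    (mu : {measure set T -> \bar R}) (D : set T) (f tau : T -> R) (j : nat)
    (z0 : R) :
  measurable D -> mu.-integrable D (EFin \o f) ->
  (forall x, D x -> 0 <= f x) -> measurable_fun D tau ->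
  (forall x, D x -> 0 <= tau x <= 1) -> z0 < 1 ->
  forall z, `|z - z0| < 1 - z0 ->
  pseries (fun k => 'C(k + j, j)%:R *
      \int[mu]_(x in D) (f x * (tau x ^+ k * (1 - z0 * tau x) ^- (k + j.+1))))
    (z - z0) @ \oo --> stieltjes mu D f tau j.+1 z.
Proof.
move=> mD fi f0 mtau tau01 z01 z zz0.
have z1 : 1 - z0 > 0 by rewrite subr_gt0.
have iK y m k : y < 1 -> mu.-integrable D
    (EFin \o (fun x => f x * (tau x ^+ k * (1 - y * tau x) ^- m))).
  exact: integrable_stieltjes.
have zlt1 : z < 1 by have := ler_norm (z - z0); lra.
pose r := `|z - z0| / (1 - z0).
have r01 : 0 <= r < 1 by rewrite /r divr_ge0 ?(ltW z1)//= ltr_pdivrMr// mul1r.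
have [e [e0 He]] := negbin_expansion j z01 r01.
pose c k x : R := 'C(k + j, j)%:R * (tau x ^+ k * (1 - z0 * tau x) ^- (k + j.+1))
                         * (z - z0) ^+ k.
have ic k : mu.-integrable D (EFin \o (fun x => f x * c k x)).
  have := integrableZl mD ('C(k + j, j)%:R * (z - z0) ^+ k) (iK z0 (k + j.+1)%N k z01).
  apply: eq_integrable => // x _ /=; rewrite -EFinM /c; congr EFin; ring.
have isum n : mu.-integrable D
    (EFin \o (fun x => f x * \sum_(0 <= k < n) c k x)).
  elim: n => [|n IH].
    have := integrable0 mu D.
    by apply: eq_integrable => // x _ /=; rewrite big_geq// mulr0.
  have := integrableD mD IH (ic n).
  apply: eq_integrable => // x _ /=; rewrite -EFinD big_nat_recr//=.
  by rewrite -mulrDr.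
have pE n : pseries (fun k => 'C(k + j, j)%:R *
      \int[mu]_(x in D) (f x * (tau x ^+ k * (1 - z0 * tau x) ^- (k + j.+1))))
    (z - z0) n = \int[mu]_(x in D) (f x * \sum_(0 <= k < n) c k x).
  rewrite /pseries /series/=; elim: n => [|n IH].
    rewrite big_geq//; rewrite -[LHS](Rintegral_set0 mu (fun=> 0)).
    under [RHS]eq_Rintegral do rewrite big_geq// mulr0.
    by rewrite !Rintegral_cst// ?mul0r.
  rewrite big_nat_recr//= IH.
  under [in RHS]eq_Rintegral do rewrite big_nat_recr//= mulrDr.
  rewrite RintegralD//; congr (_ + _).
  rewrite mulrAC -RintegralZl//; last exact: iK.
  by apply: eq_Rintegral => x _; rewrite /c; ring.
have iz : mu.-integrable D (EFin \o (fun x => f x * (1 - z * tau x) ^- j.+1)).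
  have := iK z j.+1 0%N zlt1; apply: eq_integrable => // x _ /=.
  by rewrite expr0 mul1r.
apply/cvgrPdist_le => eps eps0.
pose I := \int[mu]_(x in D) f x.
have I0 : 0 <= I by exact: Rintegral_ge0.
(* The tolerance is eps / (I + 1), since I may be 0. *)
have /cvgrPdist_le/(_ _ (divr_gt0 eps0 (ltr_wpDl I0 ltr01))) := e0.
apply: filterS => n; rewrite sub0r normrN => en.
rewrite pE /stieltjes -RintegralB//.
apply: (@le_trans _ _ (I * `|e n|)); last first.
  have I1 : 0 < I + 1 by rewrite ltr_wpDl.
  rewrite ler_pdivlMr// in en; apply: le_trans en.
  by rewrite mulrC ler_wpM2l// lerDl.
have iB : mu.-integrable D (EFin \o (fun x =>
    f x * (1 - z * tau x) ^- j.+1 - f x * \sum_(0 <= k < n) c k x)).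
  have := integrableB mD iz (isum n).
  by apply: eq_integrable => // x _ /=; rewrite -EFinB.
rewrite (le_trans (le_normr_Rintegral mD iB))// /I -RintegralZr//.
apply: le_Rintegral => //.
- by apply: integrable_norm.
- by apply: (integrableM_bounded (h := fun=> _) (C := `|e n|)) => //; rewrite normr_id.
move=> x Dx; rewrite -mulrBr normrM (ger0_norm (f0 _ Dx)) ler_wpM2l ?f0//.
rewrite (le_trans (He n z (tau x) (tau01 _ Dx) _)) ?ler_norm//.
by rewrite /r divfK// gt_eqF.
Qed.

(** * Identity theorem *)

Lemma pseries_behead (R : realType) (a : R^nat) (y l : R) :
  y != 0 -> pseries a y @ \oo --> l ->
  pseries (fun k => a k.+1) y @ \oo --> (l - a 0%N) / y.
Proof.
move=> y0; rewrite -(cvg_shiftS (pseries a y)) => al.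
suff -> : pseries (fun k => a k.+1) y =
    (fun n => (pseries a y n.+1 - a 0%N) / y).
  by apply: cvgMr_tmp; apply: cvgB => //; exact: cvg_cst.
apply/funext => n; rewrite /pseries /series/= big_nat_recl// expr0 mulr1.
rewrite [a 0%N + _]addrC addrK mulr_suml; apply: eq_bigr => k _.
by rewrite exprS; field.
Qed.

(** With y = z - x0 the factor x0 + y is z itself, so these are the coefficients at x0 of P(z) - c z
    H(z). Multiplication by y shifts the index, whence the [match] on k. *)
Lemma pseries_sub_mulX (R : realType) (p h : R^nat) (c x0 y P H : R) :
  pseries p y @ \oo --> P -> pseries h y @ \oo --> H ->
  pseries (fun k => p k - c * (x0 * h k + (if k is i.+1 then h i else 0))) y
    @ \oo --> P - c * ((x0 + y) * H).
Proof.
move=> pP hH; rewrite -(cvg_shiftS (pseries _ y)).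
have -> : [sequence pseries
      (fun k => p k - c * (x0 * h k + (if k is i.+1 then h i else 0))) y n.+1]_n
    = (fun n => pseries p y n.+1 - c * (x0 * pseries h y n.+1 + y * pseries h y n)).
  apply/funext => n; rewrite /pseries /series/=.
  rewrite [\sum_(0 <= k < n.+1) (_ - _) * _](eq_bigr (fun k =>
    p k * y ^+ k - c * (x0 * (h k * y ^+ k)
       + (if k is i.+1 then h i else 0) * y ^+ k))); last by case=> [|k] _; ring.
  rewrite sumrB -mulr_sumr big_split/= -mulr_sumr; congr (_ - _ * (_ + _)).
  rewrite big_nat_recl//= mul0r add0r mulr_sumr; apply: eq_bigr => k _.
  by rewrite exprS; ring.
rewrite mulrDl; apply: cvgB; first by rewrite (cvg_shiftS (pseries p y)).
apply: cvgMl_tmp; apply: cvgD; apply: cvgMl_tmp => //.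
by rewrite (cvg_shiftS (pseries h y)).
Qed.

(** Dividing by y shows that the shifted series sums to - a 0 / y; it is bounded by a constant B for
    small y, so |a 0| <= y B, and y tends to 0. Only points to the right of the centre enter, as the
    identity theorem requires. *)
Lemma pseries_eq0_head (R : realType) (a : R^nat) (r : R) : 0 < r ->
  (forall y, 0 < y < r -> pseries a y @ \oo --> (0 : R)) -> a 0%N = 0.
Proof.
move=> r0 a0; pose y0 := r / 2; pose y1 := r / 4.
have cb y : 0 < y < r ->
    pseries (fun k => a k.+1) y @ \oo --> (0 - a 0%N) / y.
  by move=> /[dup] /andP[y_gt0 _] yr; apply: pseries_behead (a0 _ yr); rewrite gt_eqF.
have cnorm : cvgn (pseries (fun k => `|a k.+1|) y1).
  apply: (@is_cvg_pseries_inside_norm _ _ y0).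
    by apply/cvg_ex; exists ((0 - a 0%N) / y0); apply: cb; rewrite /y0; lra.
  by rewrite /y0 /y1 !gtr0_norm; lra.
set B := limn (pseries (fun k => `|a k.+1|) y1) in cnorm *.
have aB y : 0 < y < y1 -> `|a 0%N| <= y * B.
  move=> /andP[y_gt0 yy1].
  have yr : 0 < y < r by move: yy1; rewrite /y1; lra.
  have := cb _ yr; rewrite sub0r => /cvg_norm => cn.
  have : `|- a 0%N / y| <= B.
    apply: (ler_cvg_to cn cnorm); near=> n.
    rewrite /pseries /series/= (le_trans (ler_norm_sum _ _ _))//.
    apply: ler_sum => k _; rewrite normrM ler_wpM2l// normrX gtr0_norm//.
    by apply: lerXn2r; rewrite ?nnegrE ltW// (lt_trans y_gt0).
  by rewrite normrM normrN normfV (gtr0_norm y_gt0) ler_pdivrMr// mulrC.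
have y10 : 0 < y1 by rewrite /y1; lra.
apply/eqP; rewrite -normr_le0; apply/ler_addgt0Pl => e e0; rewrite addr0.
have B0 : 0 <= B.
  have h : 0 < y1 / 2 < y1 by lra.
  by have := le_trans (normr_ge0 _) (aB _ h); rewrite pmulr_rge0//; lra.
pose y := Num.min (y1 / 2) (e / (B + 1)).
have B1 : 0 < B + 1 by lra.
have hy : 0 < y < y1.
  have q0 : 0 < e / (B + 1) by exact: divr_gt0.
  by rewrite /y lt_min gt_min q0 andbT; apply/andP; split; [|apply/orP; left]; lra.
apply: (le_trans (aB _ hy)); apply: (@le_trans _ _ (e / (B + 1) * B)).
  by rewrite ler_wpM2r// /y ge_min lexx orbT.
by rewrite mulrAC ler_pdivrMr// ler_wpM2l ?ltW//; lra.
Unshelve. all: by end_near. Qed.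

Lemma pseries_eq0 (R : realType) (a : R^nat) (r : R) : 0 < r ->
  (forall y, 0 < y < r -> pseries a y @ \oo --> (0 : R)) -> forall k, a k = 0.
Proof.
move=> r0 h k; elim: k a h => [|k IH] a h; first exact: pseries_eq0_head h.
apply: (IH (fun i => a i.+1)) => y /[dup] yr /andP[y0 _].
rewrite (_ : (0 : R) = (0 - a 0%N) / y); first by apply: pseries_behead (h _ yr); rewrite gt_eqF.
by rewrite (pseries_eq0_head r0 h) subrr mul0r.
Qed.

(** Let m be the supremum of the points where f does not vanish. Just to the right of m, f is zero,
    so its power series at m is zero, so f also vanishes just to the left of m: a contradiction. *)
Lemma analytic_eq0 (R : realType) (f : R -> R) :
  (forall z, z < 1 -> real_analytic_at f z) ->
  (forall z, `|z| < 1 -> f z = 0) -> forall z, z < 1 -> f z = 0.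
Proof.
move=> fa f0 z z1; apply/eqP/negPn/negP => fz0.
pose E := [set x | x <= -1 /\ f x != 0].
have Eub x : x < 1 -> f x != 0 -> E x.
  move=> x1 fx; split => //; rewrite leNgt; apply: contra fx => x1'.
  by rewrite f0// ltr_norml x1' x1.
have Ez : E z by exact: Eub.
have hE : has_sup E by split; [exists z|exists (-1) => x []].
set m := sup E.
have m1 : m <= -1 by apply: ge_sup => [|x []//]; exists z.
have [a [r [r0 ar]]] : real_analytic_at f m by apply: fa; lra.
have ak0 : forall k, a k = 0.
  (* The cap at 1 keeps m + y below 1, because m <= -1. *)
  apply: (@pseries_eq0 _ a (Num.min r 1)); first by rewrite lt_min r0 ltr01.
  move=> y; rewrite lt_min => /and3P[y0 yr y1].
  have := ar (m + y); rewrite [m + y]addrC addrK gtr0_norm// => /(_ yr).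
  suff -> : f (y + m) = 0 by [].
  apply/eqP/negPn/negP => fym.
  have : E (y + m) by apply: Eub => //; lra.
  move/(ub_le_sup hE.2); rewrite -/m; lra.
have [x Ex mx] := sup_adherent r0 hE.
have xm : x <= m by exact: (ub_le_sup hE.2).
have : f x = 0.
  have := ar x; rewrite -/m in mx.
  have -> : `|x - m| < r by rewrite ler0_norm; lra.
  move=> /(_ isT) h; suff h0 : pseries a (x - m) @ \oo --> (0 : R).
    exact: (cvg_unique _ h h0).
  rewrite (_ : pseries a _ = fun=> 0); first exact: cvg_cst.
  by apply/funext => n; rewrite /pseries /series/= big1// => k _; rewrite ak0 mul0r.
by move: Ex => [_ /eqP].
Qed.

Lemma is_hyp2F1_unique (R : realType) (a b c : R) (g1 g2 : R -> R) :
  is_hyp2F1 a b c g1 -> is_hyp2F1 a b c g2 -> forall z, z < 1 -> g1 z = g2 z.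
Proof.
move=> [s1 a1] [s2 a2] z z1; apply/eqP; rewrite -subr_eq0; apply/eqP.
apply: (@analytic_eq0 _ (fun z => g1 z - g2 z)) => // {z1}z z1; last first.
  by rewrite (cvg_unique _ (s1 _ z1) (s2 _ z1)) ?subrr.
have [p1 [r1 [r10 h1]]] := a1 _ z1; have [p2 [r2 [r20 h2]]] := a2 _ z1.
exists (fun k => p1 k - p2 k), (Num.min r1 r2); split; first by rewrite lt_min r10.
move=> x; rewrite lt_min => /andP[x1 x2].
rewrite (_ : pseries _ _ = fun n => pseries p1 (x - z) n - pseries p2 (x - z) n).
  by apply: cvgB; [exact: h1|exact: h2].
apply/funext => n; rewrite /pseries /series/= -sumrB.
by apply: eq_bigr => k _; rewrite mulrBl.
Qed.

(** By uniqueness of the continuation, the value picked by [xget] is the one given by any known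
    continuation. *)
Lemma hyp2F1E (R : realType) (a b c z : R) (g : R -> R) :
  is_hyp2F1 a b c g -> z < 1 -> hyp2F1 a b c z = g z.
Proof.
move=> hg z1; rewrite /hyp2F1; case: xgetP => [y _ [g' hg' ->]|/(_ (g z))].
  exact: is_hyp2F1_unique hg' hg _ z1.
by case; exists g.
Qed.

(** * The Gauss function with parameters (-s, M; 1 - s) *)

Lemma powR_continuous_at (R : realType) (p x : R) :
  0 < x -> {for x, continuous (fun a : R => a `^ p)}.
Proof.
move=> x0; apply: differentiable_continuous; apply/derivable1_diffP.
by have [] := is_derive1_powR p x0.
Qed.

Lemma ln_cvgy (R : realType) : @ln R x @[x --> +oo] --> +oo.
Proof.
apply/cvgryPge => A; near=> x.
have : expR A <= x by near: x; apply: nbhs_pinfty_ge; exact: num_real.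
move=> Ax; have x0 : 0 < x by apply: lt_le_trans Ax; exact: expR_gt0.
by rewrite -[A]expRK ler_ln ?posrE ?expR_gt0.
Unshelve. all: by end_near. Qed.

Lemma powRN_cvgy (R : realType) (p : R) :
  0 < p -> x `^ (- p) @[x --> +oo] --> (0 : R).
Proof.
move=> p0; have h : expR (- (p * ln x)) @[x --> +oo] --> (0 : R).
  apply: (cvg_comp (fun x : R => p * ln x) (fun y => expR (- y))).
    by apply: gt0_cvgMry => //; exact: ln_cvgy.
  exact: cvgr_expR.
apply: cvg_trans h; apply: near_eq_cvg; near=> x.
have x0 : 0 < x by near: x; apply: nbhs_pinfty_gt; exact: num_real.
by rewrite /powR (gt_eqF x0) mulNr.
Unshelve. all: by end_near. Qed.

Lemma integral_derive_y (R : realType) (f F : R -> R) (a l : R) :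
  (forall x, a <= x -> 0 <= f x) ->
  (forall x, a <= x -> {for x, continuous f}) ->
  (forall x, a <= x -> is_derive x 1 F (f x)) ->
  F x @[x --> +oo] --> l ->
  (\int[lebesgue_measure]_(x in `[a, +oo[) (f x)%:E = (l - F a)%R%:E)%E.
Proof.
move=> f0 cf dF Fl; rewrite (ge0_continuous_FTC2y f0 _ Fl) ?EFinB//.
- apply/continuous_within_itvcyP; split.
    by move=> x; rewrite in_itv/= andbT => /ltW; exact: cf.
  by apply: cvg_at_right_filter; exact: cf.
- by move=> x /ltW /dF [].
- apply: cvg_at_right_filter; apply: differentiable_continuous.
  by apply/derivable1_diffP; have [] := dF a (lexx a).
- move=> x; rewrite in_itv/= andbT => /ltW /dF [_ <-].
  by rewrite derive1E.
Qed.

Lemma integral_powRN (R : realType) (p : R) : 0 < p ->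
  (\int[lebesgue_measure]_(x in `[1%R, +oo[) (x `^ (- p - 1))%R%:E = (p^-1)%R%:E)%E.
Proof.
move=> p0.
pose F (x : R) := - p^-1 * x `^ (- p).
have dF (x : R) : 1 <= x -> is_derive x 1 F (x `^ (- p - 1)).
  move=> x1; have x0 : 0 < x by lra.
  apply: (is_derive_eq (is_deriveZ (- p^-1) (is_derive1_powR (- p) x0))).
  by rewrite /GRing.scale/= mulrA mulrNN mulVf ?mul1r// gt_eqF.
have F0 : F x @[x --> +oo] --> (0 : R).
  by rewrite -[X in _ --> X](mulr0 (- p^-1)); apply: cvgMl_tmp; exact: powRN_cvgy.
rewrite (integral_derive_y _ _ dF F0).
- by rewrite /F powR1 mulr1 sub0r opprK.
- by move=> x _; exact: powR_ge0.
- by move=> x x1; apply: powR_continuous_at; lra.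
Qed.

Lemma powR_mulVX (R : realType) (p x : R) (k : nat) : 0 < x ->
  x `^ p * x^-1 ^+ k = x `^ (p - k%:R).
Proof.
move=> x0; rewrite powRB; last by rewrite (lt0r_neq0 x0) implybT.
by rewrite powR_mulrn ?(ltW x0)// exprVn.
Qed.

Lemma integrable_powRN (R : realType) (p : R) : 0 < p ->
  (@lebesgue_measure R).-integrable `[1, +oo[ (EFin \o (fun x => x `^ (- p - 1))).
Proof.
move=> p0; apply/integrableP; split.
  by apply/measurable_EFinP/measurable_funTS; exact: measurable_powR.
under eq_integral do rewrite /= ger0_norm ?powR_ge0//.
by rewrite integral_powRN// ltry.
Qed.

(* The substitution w = 1/t in the integral over ]0, 1] moves the singularity
   of t^(-s) at 0 to infinity, so that FTC on [1, +oo[ computes all moments. *)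
Definition euler_stieltjes (R : realType) (s : R) (m : nat) (z : R) : R :=
  stieltjes (@lebesgue_measure R) `[1, +oo[ (fun w => w `^ (s - 2)) (fun w => w^-1)
    m z.

Lemma euler_moment (R : realType) (s : R) (k : nat) : s < 1 ->
  \int[@lebesgue_measure R]_(w in `[1, +oo[) (w `^ (s - 2) * w^-1 ^+ k)
  = (k%:R + 1 - s)^-1.
Proof.
move=> s1; have p0 : 0 < k%:R + 1 - s by have := ler0n R k; lra.
rewrite /Rintegral -[RHS]/(fine ((k%:R + 1 - s)^-1)%:E) -(integral_powRN p0).
congr fine; apply: eq_integral => w; rewrite inE/= in_itv/= andbT => w1.
rewrite powR_mulVX; last by lra.
by congr (_ `^ _)%:E; ring.
Qed.

Lemma integrable_euler_weight (R : realType) (s : R) : s < 1 ->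
  (@lebesgue_measure R).-integrable `[1, +oo[ (EFin \o (fun w => w `^ (s - 2))).
Proof.
move=> s1; have -> : s - 2 = - (1 - s) - 1 by ring.
by apply: integrable_powRN; lra.
Qed.

Lemma measurable_inv_itv1y (R : realType) :
  measurable_fun `[(1 : R), +oo[ (fun w : R => w^-1).
Proof.
apply: (eq_measurable_fun (fun x => x `^ (-1))).
  move=> x; rewrite inE/= in_itv/= andbT => x1.
  by rewrite powR_inv1//; lra.
by apply: measurable_funTS; exact: measurable_powR.
Qed.

Lemma inv_itv1y (R : realType) (w : R) : w \in `[1, +oo[ -> 0 <= w^-1 <= 1.
Proof.
rewrite in_itv/= andbT => w1.
by rewrite invr_ge0 (le_trans ler01 w1)/= invf_le1// (lt_le_trans ltr01 w1).
Qed.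

Lemma integrable_euler_stieltjes (R : realType) (s z : R) (m : nat) :
  s < 1 -> z < 1 -> (@lebesgue_measure R).-integrable `[1, +oo[
    (EFin \o (fun w => w `^ (s - 2) * (1 - z * w^-1) ^- m)).
Proof.
move=> s1 z1; have := @integrable_stieltjes _ _ _ (@lebesgue_measure R) `[1, +oo[
  _ _ 0 m z _ (integrable_euler_weight s1) (@measurable_inv_itv1y R)
  (@inv_itv1y R) z1.
move=> /(_ (measurable_itv _)); apply: eq_integrable => // w _ /=.
by rewrite expr0 mul1r.
Qed.

Lemma euler_stieltjes_pseries (R : realType) (s z0 : R) (j : nat) :
  s < 1 -> z0 < 1 -> forall z, `|z - z0| < 1 - z0 ->
  pseries (fun k => 'C(k + j, j)%:R *
      \int[@lebesgue_measure R]_(w in `[1, +oo[)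
         (w `^ (s - 2) * (w^-1 ^+ k * (1 - z0 * w^-1) ^- (k + j.+1))))
    (z - z0) @ \oo --> euler_stieltjes s j.+1 z.
Proof.
move=> s1 z01; apply: stieltjes_pseries => //.
- exact: integrable_euler_weight.
- by move=> w _; exact: powR_ge0.
- exact: measurable_inv_itv1y.
- by move=> w; exact: inv_itv1y.
Qed.

(** The uniform expansion taken at t = 1. *)
Lemma negbin_pseries (R : realType) (m : nat) (z0 : R) :
  z0 < 1 -> forall z, `|z - z0| < 1 - z0 ->
  pseries (fun k => 'C(k + m, m)%:R * (1 - z0) ^- (k + m.+1)) (z - z0)
    @ \oo --> (1 - z) ^- m.+1.
Proof.
move=> z01 z zz0; have z1 : 0 < 1 - z0 by rewrite subr_gt0.
pose r := `|z - z0| / (1 - z0).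
have r01 : 0 <= r < 1 by rewrite /r divr_ge0 ?(ltW z1)//= ltr_pdivrMr// mul1r.
have [e [e0 He]] := negbin_expansion m z01 r01.
apply/cvgrPdist_le => eps eps0.
move/cvgrPdist_le : e0 => /(_ _ eps0); apply: filterS => n.
rewrite sub0r normrN => /(le_trans (ler_norm _)); apply: le_trans.
have := He n z 1; rewrite ler01 lexx !mulr1.
have -> : r * (1 - z0) = `|z - z0| by rewrite /r divfK// gt_eqF.
move=> /(_ isT (lexx _)); rewrite /pseries /series/=.
by under eq_bigr do rewrite expr1n mul1r.
Qed.

(** * Gauss coefficients and the closed form of the continuation *)

Lemma pochhammerS (R : realType) (a : R) (n : nat) :
  pochhammer a n.+1 = pochhammer a n * (a + n%:R).
Proof. by rewrite /pochhammer big_ord_recr. Qed.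

(** After multiplication by m!, both sides equal (k + m)!. *)
Lemma pochhammer_nat (R : realType) (m k : nat) :
  pochhammer (m.+1%:R : R) k = 'C(k + m, m)%:R * k`!%:R.
Proof.
have mf : m`!%:R != 0 :> R by rewrite pnatr_eq0 -lt0n fact_gt0.
apply: (mulIf mf); rewrite -mulrA -!natrM [(k`! * _)%N]mulnC.
have := bin_fact (leq_addl k m); rewrite addnK => ->.
elim: k => [|k IH]; first by rewrite /pochhammer big_ord0 mul1r.
rewrite pochhammerS mulrAC IH addSn factS mulnC natrM; congr (_ * _).
by rewrite -natrD addSn addnC.
Qed.

(** Both sides are the Pochhammer symbol of - s of length k + 1, with its last, respectively its
    first, factor split off. *)
Lemma pochhammer_shift (R : realType) (s : R) (k : nat) :
  pochhammer (- s) k * (k%:R - s) = - s * pochhammer (1 - s) k.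
Proof.
elim: k => [|k IH]; first by rewrite /pochhammer !big_ord0; ring.
rewrite !pochhammerS mulrA -IH -natr1; ring.
Qed.

Lemma pochhammer_gt0 (R : realType) (a : R) (k : nat) :
  0 < a -> 0 < pochhammer a k.
Proof. by move=> a0; apply: prodr_gt0 => i _; rewrite ltr_wpDr. Qed.

Lemma hyp2F1_coef0 (R : realType) (a b c : R) : hyp2F1_coef a b c 0 = 1.
Proof. by rewrite /hyp2F1_coef /pochhammer !big_ord0 fact0 !mul1r invr1. Qed.

(** The quotient of the symbols of - s and 1 - s is - s / (k + 1 - s) = 1 - (k + 1) / (k + 1 - s).
    The two summands match the power (1 - z)^(-(m+1)) and the moments of [euler_moment]. *)
Lemma hyp2F1_coefS (R : realType) (s : R) (m k : nat) : s < 1 ->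
  hyp2F1_coef (- s) m.+1%:R (1 - s) k.+1 =
  'C(k.+1 + m, m)%:R - m.+1%:R * ('C(k + m.+1, m.+1)%:R / (k%:R + 1 - s)).
Proof.
move=> s1; rewrite /hyp2F1_coef pochhammer_nat.
have p0 := pochhammer_gt0 k.+1 (_ : 0 < 1 - s).
have {}p0 : pochhammer (1 - s) k.+1 != 0 by rewrite gt_eqF// p0; lra.
have f0 : k.+1`!%:R != 0 :> R by rewrite pnatr_eq0 -lt0n fact_gt0.
have ks : k%:R + 1 - s != 0 by rewrite gt_eqF//; have := ler0n R k; lra.
have -> : pochhammer (- s) k.+1 = - s * pochhammer (1 - s) k.+1 / (k%:R + 1 - s).
  by rewrite -pochhammer_shift -natr1 mulfK.
have -> : m.+1%:R * ('C(k + m.+1, m.+1)%:R / (k%:R + 1 - s))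
    = k.+1%:R * 'C(k.+1 + m, m)%:R / (k%:R + 1 - s) :> R.
  by rewrite mulrA -!natrM addnS mul_bin_left addSn subSn ?leq_addl// addnK.
rewrite -[k.+1%:R]natr1; field.
by rewrite ks f0 p0.
Qed.

(** Here M = m + 1, so the kernel exponent M + 1 is m + 2. *)
Definition euler_hyp2F1 (R : realType) (s : R) (m : nat) (z : R) : R :=
  (1 - z) ^- m.+1 - m.+1%:R * (z * euler_stieltjes s m.+2 z).

Lemma euler_hyp2F1P (R : realType) (s : R) (m : nat) : s < 1 ->
  is_hyp2F1 (- s) m.+1%:R (1 - s) (@euler_hyp2F1 R s m).
Proof.
move=> s1.
(* One expansion at an arbitrary centre serves twice: z0 = 0 identifies the Gauss coefficients, and
   general z0 < 1 gives analyticity with radius 1 - z0. *)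
have key (z0 z : R) (z01 : z0 < 1) (zz0 : `|z - z0| < 1 - z0) := pseries_sub_mulX
  (c := m.+1%:R) (x0 := z0) (negbin_pseries (m := m) z01 zz0)
  (euler_stieltjes_pseries (j := m.+1) s1 z01 zz0).
split=> [z z1|z0 z01].
  have h0 : `|z - 0| < 1 - 0 by rewrite !subr0.
  have := key _ _ ltr01 h0; rewrite add0r [z - 0]subr0 -/(euler_hyp2F1 s m z).
  set a := (X in pseries X); suff -> : hyp2F1_coef (- s) m.+1%:R (1 - s) = a by [].
  apply/funext => -[|k]; rewrite {}/a.
    by rewrite hyp2F1_coef0 binn subr0 expr1n invr1; ring.
  rewrite hyp2F1_coefS// subr0 expr1n invr1 mul0r add0r mulr1.
  congr (_ - _ * (_ * _)); rewrite -euler_moment//.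
  by apply: eq_Rintegral => w _; rewrite mul0r subr0 expr1n invr1 mulr1.
eexists; exists (1 - z0); split; first by rewrite subr_gt0.
move=> z zz0; have := key _ _ z01 zz0.
rewrite [z0 + _]addrC subrK; exact.
Qed.

Lemma hyp2F1_euler (R : realType) (s z : R) (m : nat) : s < 1 -> z < 1 ->
  hyp2F1 (- s) m.+1%:R (1 - s) z = euler_hyp2F1 s m z.
Proof. by move=> s1; apply: hyp2F1E; exact: euler_hyp2F1P. Qed.

Lemma euler_stieltjes_ge0 (R : realType) (s z : R) (m : nat) :
  z < 1 -> 0 <= euler_stieltjes s m z.
Proof.
move=> z1; apply: Rintegral_ge0 => w w1.
rewrite mulr_ge0 ?powR_ge0// invr_ge0 exprn_ge0// ltW//.
by apply: one_sub_mul_gt0 => //; exact: inv_itv1y.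
Qed.

(** For z <= 0 the term - M z times the integral is nonnegative and the power (1 - z)^(-M) is
    positive. *)
Lemma hyp2F1_gt0 (R : realType) (s z : R) (M : nat) : s < 1 -> z <= 0 ->
  (0 < M)%N -> 0 < hyp2F1 (- s) M%:R (1 - s) z.
Proof.
case: M => // m s1 z0 _; rewrite hyp2F1_euler//; last lra.
rewrite /euler_hyp2F1 -mulrN -mulNr ltr_pwDl ?invr_gt0 ?exprn_gt0//; first lra.
by rewrite mulr_ge0// mulr_ge0 ?oppr_ge0// euler_stieltjes_ge0//; lra.
Qed.

(** * The product of Gamma values *)

Lemma integral_expR_linear (R : realType) (c : R) : 0 < c ->
  (\int[lebesgue_measure]_(y in `[0%R, +oo[) (y * expR (- (c * y)))%:E
   = ((c ^+ 2)^-1)%R%:E)%E.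
Proof.
move=> c0; have c_neq0 := lt0r_neq0 c0.
pose F (y : R) := - ((c * y + 1) / c ^+ 2 * expR (- (c * y))).
have dE (y : R) : is_derive y 1 (fun y => expR (- (c * y))) (- c * expR (- (c * y))).
  apply: (@is_derive_eq _ _ _ _ _ _ _ (expR (- (c * y)) * (- c))); last by rewrite mulrC.
  apply: (@is_derive1_comp _ expR (fun y => - (c * y))).
  by apply: is_derive_eq; rewrite scaler1.
have dF (y : R) : 0 <= y -> is_derive y 1 F (y * expR (- (c * y))).
  move=> _; apply: (@is_derive_eq _ _ _ _ _ _ _
    (- ((c * y + 1) / c ^+ 2 *: (- c * expR (- (c * y)))
        + expR (- (c * y)) *: (c / c ^+ 2)))); last first.
    by rewrite /GRing.scale/=; field.
  apply: is_deriveN; apply: is_deriveM.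
  apply: (@is_derive_eq _ _ _ _ _ _ _ ((c ^+ 2)^-1 *: c)); last by rewrite mulrC.
  rewrite (_ : (fun y => _) = (c ^+ 2)^-1 \*: (fun y => c * y + 1)); last first.
    by apply/funext => x /=; rewrite mulrC.
  apply: is_deriveZ; have dc : is_derive y 1 (fun y => c * y) c.
    by apply: is_derive_eq; rewrite scaler1.
  by apply: (is_derive_eq (is_deriveD dc (is_derive_cst (1 : R) y 1))); rewrite addr0.
have F0 : F y @[y --> +oo] --> (0 : R).
  apply/cvgr0Pnorm_le => eps eps0; near=> y.
  (* Since c y >= 1 and expR (c y) >= (c y)^2 / 2, the norm of F y is at most 4 / (c^3 y); the
     second threshold makes this at most eps. *)
  have y1 : 1 / c <= y by near: y; apply: nbhs_pinfty_ge; exact: num_real.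
  have y2 : 4 / (c ^+ 3 * eps) <= y by near: y; apply: nbhs_pinfty_ge; exact: num_real.
  have c3 : 0 < c ^+ 3 * eps by rewrite mulr_gt0// exprn_gt0.
  have cy : 1 <= c * y by rewrite -ler_pdivrMl// mulrC.
  have cy0 : 0 < c * y by lra.
  have y0 : 0 < y by rewrite -(pmulr_rgt0 _ c0).
  have ex : (c * y) ^+ 2 / 2 <= expR (c * y).
    apply: le_trans (expR_ge1Dxn 1 (ltW cy0)).
    by rewrite (_ : 2`!%:R = 2 :> R)// lerDr.
  rewrite /F normrN ger0_norm; last first.
    by rewrite mulr_ge0 ?expR_ge0// divr_ge0 ?exprn_ge0 ?(ltW c0)//; lra.
  rewrite expRN ler_pdivrMr ?expR_gt0//.
  apply: (@le_trans _ _ (eps * ((c * y) ^+ 2 / 2))); last first.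
    by rewrite ler_wpM2l// ltW.
  rewrite ler_pdivrMr ?exprn_gt0//.
  move: y2; rewrite ler_pdivrMr// => y2.
  have : 4 * (c * y) <= y * (c ^+ 3 * eps) * (c * y) by rewrite ler_wpM2r// ltW.
  nra.
rewrite (integral_derive_y _ _ dF F0).
- by congr _%:E; rewrite /F mulr0 oppr0 expR0; field.
- by move=> y y0; rewrite mulr_ge0// expR_ge0.
- move=> y y0; apply: differentiable_continuous; apply/derivable1_diffP.
  by apply: derivableM => //; have [] := dE y.
Unshelve. all: by end_near. Qed.

(** Tonelli on the whole plane, applied to the extension of k by zero outside the rectangle. *)
Lemma ge0_fubini_setX (R : realType) (A B : set R) (k : R * R -> R) :
  measurable A -> measurable B -> measurable_fun setT k ->
  (forall x y, A x -> B y -> 0 <= k (x, y)) ->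
  (\int[lebesgue_measure]_(x in A) \int[lebesgue_measure]_(y in B) (k (x, y))%:E
   = \int[lebesgue_measure]_(y in B) \int[lebesgue_measure]_(x in A) (k (x, y))%:E)%E.
Proof.
move=> mA mB mk k0; pose mu := @lebesgue_measure R.
pose f := (EFin \o k) \_ (A `*` B).
have AB x y : A x -> B y -> f (x, y) = (k (x, y))%:E.
  by move=> Ax By; rewrite /f patchE mem_set.
have NA x y : ~ A x -> f (x, y) = 0%E.
  by move=> Ax; rewrite /f patchE memNset// => -[].
have NB x y : ~ B y -> f (x, y) = 0%E.
  by move=> By; rewrite /f patchE memNset// => -[].
transitivity (\int[mu]_x \int[mu]_y f (x, y))%E.
  rewrite integral_mkcond; apply: eq_integral => x _; rewrite patchE.
  case: ifPn => [/set_mem Ax|/negP]; last first.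
    rewrite inE => Ax; rewrite integral0_eq// => y _; exact: NA.
  rewrite integral_mkcond; apply: eq_integral => y _; rewrite patchE.
  case: ifPn => [/set_mem By|/negP]; first by rewrite AB.
  by rewrite inE => By; rewrite NB.
rewrite fubini_tonelli; last 2 first.
- apply/(measurable_restrictT _ _).1 => //; first exact: measurableX.
  by apply/measurable_EFinP; exact: measurable_funTS.
- by move=> [x y]; rewrite /f patchE; case: ifPn => // /set_mem[/= Ax By]; rewrite lee_fin k0.
symmetry; rewrite integral_mkcond; apply: eq_integral => y _; rewrite patchE.
case: ifPn => [/set_mem By|/negP]; last first.
  rewrite inE => By; rewrite integral0_eq// => x _; exact: NB.
rewrite integral_mkcond; apply: eq_integral => x _; rewrite patchE.
case: ifPn => [/set_mem Ax|/negP]; first by rewrite AB.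
by rewrite inE => Ax; rewrite NA.
Qed.

Lemma Gamma_integrand_scale (R : realType) (s c : R) : 0 < s -> 0 < c ->
  (\int[lebesgue_measure]_(x in `[0%R, +oo[) (x `^ s * expR (- x))%:E
   = \int[lebesgue_measure]_(w in `[0%R, +oo[)
       ((c * w) `^ s * expR (- (c * w)) * c)%:E)%E.
Proof.
move=> s0 c0; pose F (w : R) := c * w; pose G (x : R) := x `^ s * expR (- x).
have dF (w : R) : is_derive w 1 F c.
  by apply: is_derive_eq; rewrite scaler1.
have F'E : F^`()%classic = cst c by apply/funext => w; rewrite derive1E; have [] := dF w.
have cF : continuous F.
  by move=> w; apply: differentiable_continuous; apply/derivable1_diffP; have [] := dF w.
have cexp : continuous (fun x : R => expR (- x)).
  by move=> x; apply: continuous_comp; [exact: opp_continuous|exact: continuous_expR].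
have F0 : F 0 = 0 by rewrite /F mulr0.
transitivity (\int[lebesgue_measure]_(x in `[F 0%R, +oo[) (G x)%:E)%E.
  by rewrite F0.
rewrite (@increasing_ge0_integration_by_substitutiony _ F G 0).
- by apply: eq_integral => w _; rewrite F'E.
- by move=> x y _ _ xy; rewrite /F ltr_pM2l.
- by rewrite F'E => x _; exact: cst_continuous.
- by rewrite F'E; exact: is_cvg_cst.
- by rewrite F'E; exact: is_cvg_cst.
- split; first by move=> x _; have [] := dF x.
  exact/cvg_at_right_filter/cF.
- exact: gt0_cvgMry.
- rewrite F0; apply/continuous_within_itvcyP; split.
    move=> x; rewrite in_itv/= andbT => x0.
    by apply: cvgM; [exact: powR_continuous_at|exact: cexp].
  apply: cvgM; last exact/cvg_at_right_filter/cexp.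
  by rewrite powR0 ?gt_eqF//; exact: powR_cvg0.
- by move=> x _; rewrite /G mulr_ge0 ?powR_ge0 ?expR_ge0.
Qed.

Lemma measurable_Gamma_integrand (R : realType) (p : R) :
  measurable_fun setT (fun t : R => t `^ p * expR (- t)).
Proof.
apply: measurable_funM; first exact: measurable_powR.
by apply: measurableT_comp => //; exact: measurableT_comp.
Qed.

Lemma GammaE (R : realType) (x : R) : Gamma x =
  fine (\int[lebesgue_measure]_(t in `[0%R, +oo[) (t `^ (x - 1) * expR (- t))%:E)%E.
Proof.
rewrite /Gamma /Rintegral integral_itv_obnd_cbnd//.
by apply/measurable_EFinP/measurable_funTS; exact: measurable_Gamma_integrand.
Qed.

Lemma Gamma1 (R : realType) : Gamma (1 : R) = 1.
Proof.
pose F (y : R) := - expR (- y).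
have dF (y : R) : 0 <= y -> is_derive y 1 F (expR (- y)).
  move=> _; have h : is_derive y 1 (expR \o -%R) (expR (- y) * (- 1)).
    by apply: is_derive1_comp.
  by apply: (is_derive_eq (is_deriveN h)); rewrite mulrN1 opprK.
have F0 : F y @[y --> +oo] --> (0 : R).
  by rewrite -oppr0; apply: cvgN; exact: cvgr_expR.
rewrite GammaE.
under eq_integral do rewrite subrr powRr0 mul1r.
rewrite (integral_derive_y _ _ dF F0).
- by rewrite /= /F oppr0 expR0 sub0r opprK.
- by move=> y _; exact: expR_ge0.
- move=> x _; apply: continuous_comp; [exact: opp_continuous|exact: continuous_expR].
Qed.

(** For fixed y > 0 substitute x = (y / c) w in the second integral: the powers of y reduce to a
    single factor y. After exchanging the integrals, the one in y is [integral_expR_linear] with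
    rate 1 + w / c. Extended reals allow this before any integral is known to be finite. *)
Lemma Gamma_integral_product (R : realType) (s c : R) : 0 < s -> 0 < c ->
  ((c `^ s)%:E *
   ((\int[lebesgue_measure]_(y in `[0%R, +oo[) (y `^ (- s) * expR (- y))%:E) *
    (\int[lebesgue_measure]_(x in `[0%R, +oo[) (x `^ s * expR (- x))%:E))
   = \int[lebesgue_measure]_(w in `[0%R, +oo[) (c * w `^ s / (c + w) ^+ 2)%R%:E)%E.
Proof.
move=> s0 c0; have c_neq0 := lt0r_neq0 c0.
pose K (p : R * R) := p.2 `^ s / c * (p.1 * expR (- ((1 + p.2 / c) * p.1))).
set I1 := (X in (_ * (_ * X))%E).
have I10 : (0 <= I1)%E.
  by apply: integral_ge0 => x _; rewrite lee_fin mulr_ge0 ?powR_ge0 ?expR_ge0.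
have mG p : measurable_fun `[(0 : R), +oo[ (EFin \o (fun t : R => t `^ p * expR (- t))).
  by apply/measurable_EFinP/measurable_funTS; exact: measurable_Gamma_integrand.
have G0 p (t : R) : (0 <= (t `^ p * expR (- t))%:E)%E.
  by rewrite lee_fin mulr_ge0 ?powR_ge0 ?expR_ge0.
transitivity (\int[lebesgue_measure]_(y in `[0%R, +oo[)
    ((c `^ s)%:E * ((y `^ (- s) * expR (- y))%:E * I1)))%E.
  rewrite ge0_integralZl//; first by rewrite ge0_integralZr//; exact: mG.
  - exact: emeasurable_funM (mG _) (measurable_cst _).
  - by move=> y _; rewrite mule_ge0.
  - by rewrite lee_fin powR_ge0.
have mK : measurable_fun setT K.
  apply: measurable_funM.
    apply: measurable_funM; last exact: measurable_cst.
    apply: (@measurableT_comp _ _ _ _ _ _ (fun a : R => a `^ s) setT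
      (fun p : R * R => p.2)); [exact: measurable_powR|exact: measurable_snd].
  apply: measurable_funM; first exact: measurable_fst.
  apply: measurableT_comp => //; apply: measurableT_comp => //.
  apply: measurable_funM; last exact: measurable_fst.
  apply: measurable_funD; first exact: measurable_cst.
  apply: measurable_funM; last exact: measurable_cst.
  exact: measurable_snd.
have K0 (y w : R) : 0 <= y -> 0 <= K (y, w).
  by move=> y0; rewrite /K/= !mulr_ge0 ?powR_ge0 ?expR_ge0 ?invr_ge0 ?(ltW c0).
transitivity (\int[lebesgue_measure]_(y in `[0%R, +oo[)
    \int[lebesgue_measure]_(w in `[0%R, +oo[) (K (y, w))%:E)%E.
  (* At y = 0 both sides vanish: [powR] gives 0 the value 0 at the nonzero exponent - s, and K has
     the factor y. *)
  apply: eq_integral => y; rewrite inE/= in_itv/= andbT le_eqVlt => /predU1P[<-|y0].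
    rewrite powR0 ?oppr_eq0 ?gt_eqF// mul0r mul0e mule0 integral0_eq// => w _.
    by rewrite /K/= mul0r mulr0.
  have yc : 0 < y / c by exact: divr_gt0.
  rewrite /I1 (Gamma_integrand_scale s0 yc) muleA -EFinM -ge0_integralZl//; last 3 first.
  - apply/measurable_EFinP/measurable_funTS; apply: measurable_funM => //.
    have h : measurable_fun setT (fun w : R => y / c * w) by exact: measurable_funM.
    by have := measurableT_comp (measurable_Gamma_integrand s) h.
  - by move=> w _; rewrite lee_fin !mulr_ge0 ?powR_ge0 ?expR_ge0 ?invr_ge0 ?(ltW c0) ?(ltW y0).
  - by rewrite lee_fin !mulr_ge0 ?powR_ge0 ?expR_ge0.
  apply: eq_integral => w; rewrite inE/= in_itv/= andbT => w0; rewrite -EFinM.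
  congr _%:E; rewrite /K/= powRM ?(ltW yc)// powRM ?invr_ge0 ?(ltW c0) ?(ltW y0)// powRN.
  have -> : c^-1 `^ s = (c `^ s)^-1 by rewrite -powR_inv1 ?(ltW c0)// -powRrM mulN1r powRN.
  have -> : - ((1 + w / c) * y) = - y + - (y / c * w) by field.
  rewrite expRD; have := lt0r_neq0 (powR_gt0 s c0); have := lt0r_neq0 (powR_gt0 s y0).
  by move=> h1 h2; field; rewrite h1 h2 c_neq0.
rewrite ge0_fubini_setX//; last first.
  by move=> y w; rewrite /= in_itv/= andbT => y0 _; exact: K0.
apply: eq_integral => w; rewrite inE/= in_itv/= andbT => w0.
have w1 : 0 < 1 + w / c by rewrite ltr_pwDl// divr_ge0// (ltW c0).
rewrite /K/=.
under eq_integral do rewrite EFinM.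
rewrite ge0_integralZl//; last 3 first.
- apply/measurable_EFinP/measurable_funTS; apply: measurable_funM => //.
  by apply: measurableT_comp => //; apply: measurableT_comp => //; exact: measurable_funM.
- by move=> y; rewrite /= in_itv/= andbT => y0; rewrite lee_fin mulr_ge0// expR_ge0.
- by rewrite lee_fin divr_ge0 ?powR_ge0 ?(ltW c0).
rewrite integral_expR_linear// -EFinM; congr _%:E.
have cw : c + w != 0 by rewrite gt_eqF// ltr_pwDl.
have -> : 1 + w / c = (c + w) / c by field.
by field; rewrite cw c_neq0.
Qed.

(** * Comparison of the Gamma product with the Gauss function *)

(** From w^(-s) >= 1 + s (1 - w) follows w^s <= 1 / (1 + s (1 - w)), a convex function of w whose
    chord over [0, 1] is the right-hand side. The explicit gap below 1 makes the integral comparison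
    strict. *)
Lemma powR_le_chord (R : realType) (s w : R) : 0 < s -> 0 <= w <= 1 ->
  w `^ s <= 1 - s / (1 + s) * (1 - w).
Proof.
move=> s0 /andP[]; rewrite le_eqVlt => /predU1P[<-|w0] w1.
  rewrite powR0 ?gt_eqF// subr0 mulr1 subr_ge0 ler_pdivrMr; lra.
have lnw : ln w <= w - 1.
  have := @le_ln1Dx R (w - 1); (have -> : 1 + (w - 1) = w by ring); apply; lra.
have h1 : 1 + s * (1 - w) <= expR (- (s * ln w)).
  apply: le_trans (expR_ge1Dx _); rewrite lerD2l -mulrN ler_pM2l//; lra.
have sw : 0 <= s * (1 - w) by rewrite mulr_ge0; lra.
have h0 : 0 < 1 + s * (1 - w) by lra.
have -> : w `^ s = (expR (- (s * ln w)))^-1.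
  by rewrite expRN invrK /powR (gt_eqF w0).
apply: (@le_trans _ _ (1 + s * (1 - w))^-1); first by rewrite lef_pV2 ?posrE ?expR_gt0.
rewrite -[_^-1]mul1r ler_pdivrMr//.
have -> : s / (1 + s) * (1 - w) = s * (1 - w) / (1 + s) by rewrite mulrAC.
rewrite -subr_ge0.
have -> : (1 - s * (1 - w) / (1 + s)) * (1 + s * (1 - w)) - 1
  = s * (1 - w) * (s * w) / (1 + s) by field; lra.
by rewrite !mulr_ge0 ?invr_ge0; lra.
Qed.

Lemma measurable_beta_integrand (R : realType) (s c : R) :
  measurable_fun `[(0 : R), +oo[ (fun w : R => c * w `^ s / (c + w) ^+ 2).
Proof.
apply: (eq_measurable_fun (fun w => c * w `^ s * ((c + w) ^+ 2) `^ (-1))).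
  by move=> w _; rewrite powR_inv1// sqr_ge0.
apply: measurable_funTS; apply: measurable_funM.
  by apply: measurable_funM => //; exact: measurable_powR.
apply: (@measurableT_comp _ _ _ _ _ _ (fun a : R => a `^ (-1)) setT
  (fun w : R => (c + w) ^+ 2)); first exact: measurable_powR.
by apply: measurable_funX; exact: measurable_funD.
Qed.

Lemma beta_head_lt (R : realType) (s c : R) : 0 < s -> 0 < c ->
  (\int[lebesgue_measure]_(w in `[0%R, 1%R[) (c * w `^ s / (c + w) ^+ 2)%R%:E
   < ((1 + c)^-1)%R%:E)%E.
Proof.
(* The margin d is c times the slope in [powR_le_chord], divided by the upper bound (1 + c)^2 of (c
   + w)^2 on [0, 1]. The majorant f then integrates to 1 / (1 + c) - d / 2. *)
move=> s0 c0; pose d := c * (s / (1 + s)) / (1 + c) ^+ 2.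
have c1 : 0 < 1 + c by lra.
have d0 : 0 < d by rewrite /d !mulr_gt0 ?invr_gt0 ?exprn_gt0//; lra.
pose f (w : R) := c / (c + w) ^+ 2 - d * (1 - w).
pose F (w : R) := - c * (c + w)^-1 - d * (w - 2^-1 * (w * w)).
have mB : measurable_fun `[(0 : R), 1[ (fun w : R => c * w `^ s / (c + w) ^+ 2).
  apply: measurable_funS (measurable_beta_integrand s c) => //.
  by apply: subset_itvl; rewrite bnd_simp.
have le_f (w : R) : 0 <= w <= 1 -> c * w `^ s / (c + w) ^+ 2 <= f w.
  move=> /[dup] w01 /andP[w0 w1].
  have cw : 0 < c + w by lra.
  have -> : f w = (c - d * (1 - w) * (c + w) ^+ 2) / (c + w) ^+ 2.
    by rewrite /f mulrBl mulfK// gt_eqF// exprn_gt0.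
  rewrite ler_pM2r ?invr_gt0 ?exprn_gt0//.
  apply: (@le_trans _ _ (c * (1 - s / (1 + s) * (1 - w)))).
    by rewrite ler_pM2l// powR_le_chord.
  rewrite mulrBr mulr1 lerD2l lerN2.
  have -> : c * (s / (1 + s) * (1 - w)) = d * (1 - w) * (1 + c) ^+ 2.
    by rewrite /d; field; lra.
  rewrite ler_wpM2l//; first by rewrite mulr_ge0; lra.
  by apply: lerXn2r; rewrite ?nnegrE; lra.
have dF (w : R) : 0 <= w -> is_derive w 1 F (f w).
  move=> w0; have cw : c + w != 0 by rewrite gt_eqF//; lra.
  have h1 : is_derive w 1 (fun w => c + w) 1.
    by apply: (is_derive_eq (is_deriveD (is_derive_cst c w 1) (is_derive_id w 1)));
      rewrite add0r.
  have h2 : is_derive w 1 (fun w => w - 2^-1 * (w * w)) (1 - w).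
    have hid := is_derive_id w (1 : R).
    apply: (is_derive_eq (is_deriveB hid (is_deriveZ 2^-1 (is_deriveM hid hid)))).
    by rewrite /GRing.scale/=; field.
  apply: (is_derive_eq (is_deriveB (is_deriveZ (- c) (is_deriveV cw h1))
    (is_deriveZ d h2))).
  by rewrite /GRing.scale/= /f; field.
have cF (w : R) : 0 <= w -> {for w, continuous F}.
  move=> w0; apply: differentiable_continuous; apply/derivable1_diffP.
  by have [] := dF _ w0.
have cf (w : R) : 0 <= w -> {for w, continuous f}.
  move=> w0; apply: cvgB; last first.
    by apply: cvgMl_tmp; apply: cvgB; [exact: cvg_cst|exact: cvg_id].
  apply: cvgMl_tmp; apply: cvgV; first by rewrite sqrf_eq0 gt_eqF//; lra.
  apply: (cvg_comp (fun w => c + w) (fun x => x ^+ 2)); last exact: exprn_continuous.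
  by apply: cvgD; [exact: cvg_cst|exact: cvg_id].
have FTC : (\int[lebesgue_measure]_(w in `[0%R, 1%R]) (f w)%:E
    = (F 1)%:E - (F 0)%:E)%E.
  apply: continuous_FTC2 => //.
  - apply: continuous_in_subspaceT => w; rewrite inE/= in_itv/= => /andP[w0 _].
    exact: cf.
  - split; first by move=> w; rewrite in_itv/= => /andP[/ltW w0 _]; have [] := dF _ w0.
      by apply/cvg_at_right_filter/cF.
    by apply/cvg_at_left_filter/cF.
  - move=> w; rewrite in_itv/= => /andP[/ltW w0 _].
    by rewrite derive1E; have [] := dF _ w0.
have mf : measurable_fun `[(0 : R), 1] f.
  apply: subspace_continuous_measurable_fun => //.
  by apply: continuous_in_subspaceT => w; rewrite inE/= in_itv/= => /andP[w0 _]; exact: cf.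
apply: (@le_lt_trans _ _ ((F 1)%:E - (F 0)%:E)%E).
  rewrite -FTC -integral_itv_bndo_bndc; last first.
    apply/measurable_EFinP; apply: measurable_funS mf => //.
    by apply: subset_itvl; rewrite bnd_simp.
  apply: ge0_le_integral => //.
  - by move=> w _; rewrite lee_fin !mulr_ge0 ?powR_ge0 ?invr_ge0 ?sqr_ge0 ?(ltW c0).
  - exact/measurable_EFinP.
  - apply/measurable_EFinP; apply: measurable_funS mf => //.
    by apply: subset_itvl; rewrite bnd_simp.
  - move=> w; rewrite /= in_itv/= => /andP[w0 w1]; rewrite lee_fin.
    by apply: le_f; rewrite w0 ltW.
rewrite -EFinB lte_fin.
have -> : F 1 - F 0 = (1 + c)^-1 - d / 2.
  by rewrite /F; field; lra.
lra.
Qed.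

(** Split the integral of [Gamma_integral_product] at 1. Its tail is exactly the integral term of
    [euler_hyp2F1] at - c, so only the head has to be compared with 1 / (1 + c). *)
Lemma Gamma_product_lt (R : realType) (s c : R) : 0 < s < 1 -> 0 < c ->
  Gamma (1 - s) * Gamma (1 + s) * c `^ s < euler_hyp2F1 s 0 (- c).
Proof.
move=> /andP[s0 s1] c0.
have c1 : 0 < 1 + c by lra.
have := Gamma_integral_product s0 c0; rewrite !GammaE.
have -> : 1 - s - 1 = - s by ring.
have -> : 1 + s - 1 = s by ring.
set I2 := (X in (_ * (X * _))%E); set I1 := (X in (_ * (_ * X))%E).
set J := (X in _ = X) => IJ.
change (fine I2 * fine I1 * c `^ s < euler_hyp2F1 s 0 (- c)).
pose A := (\int[lebesgue_measure]_(w in `[0%R, 1%R[) (c * w `^ s / (c + w) ^+ 2)%R%:E)%E.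
have A0 : (0 <= A)%E.
  apply: integral_ge0 => w _.
  by rewrite lee_fin !mulr_ge0 ?powR_ge0 ?invr_ge0 ?sqr_ge0 ?(ltW c0).
have A1 : (A < ((1 + c)^-1)%:E)%E by exact: beta_head_lt.
have Afin : A \is a fin_num by rewrite ge0_fin_numE// (lt_trans A1)// ltry.
have JE : (J = A + (c * euler_stieltjes s 2 (- c))%:E)%E.
  rewrite /J; have -> : `[(0 : R), +oo[%classic = `[0, 1[ `|` `[1, +oo[.
    by rewrite -itv_bndbnd_setU// bnd_simp.
  rewrite ge0_integral_setU//=; last 3 first.
  - apply/measurable_EFinP; apply: measurable_funS (measurable_beta_integrand s c) => //.
    by move=> w [|]; rewrite /= !in_itv/= ?andbT; lra.
  - by move=> w _; rewrite lee_fin !mulr_ge0 ?powR_ge0 ?invr_ge0 ?sqr_ge0 ?(ltW c0).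
  - apply/disj_setPS => w [] /=; rewrite !in_itv/= => /andP[_ +] /andP[+ _].
    by move=> /lt_le_trans h /h; rewrite ltxx.
  congr (_ + _)%E.
  have cz : - c < 1 by lra.
  have ci := integrable_euler_stieltjes 2 s1 cz.
  rewrite /euler_stieltjes /stieltjes EFinM /Rintegral fineK; last first.
    exact: integrable_fin_num ci.
  rewrite -ge0_integralZl//; last 3 first.
  - exact: (measurable_int _ ci).
  - move=> w w1; rewrite lee_fin mulr_ge0 ?powR_ge0// invr_ge0 exprn_ge0// ltW//.
    by apply: one_sub_mul_gt0 => //; exact: inv_itv1y.
  - by rewrite lee_fin ltW.
  apply: eq_integral => w; rewrite inE/= in_itv/= andbT => w1; rewrite -EFinM.
  congr _%:E; have w0 : 0 < w by lra.
  have w_neq0 := lt0r_neq0 w0.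
  have cw : c + w != 0 by rewrite gt_eqF//; lra.
  rewrite powRB; last by rewrite w_neq0 implybT.
  rewrite powR_mulrn ?(ltW w0)//.
  have -> : 1 - - c * w^-1 = (c + w) / w by field.
  by field; rewrite cw w_neq0.
have I10 : (0 <= I1)%E.
  by apply: integral_ge0 => x _; rewrite lee_fin mulr_ge0 ?powR_ge0 ?expR_ge0.
have I20 : (0 <= I2)%E.
  by apply: integral_ge0 => x _; rewrite lee_fin mulr_ge0 ?powR_ge0 ?expR_ge0.
have E0 : 0 <= c * euler_stieltjes s 2 (- c).
  by rewrite mulr_ge0 ?(ltW c0)// euler_stieltjes_ge0//; lra.
apply: (@le_lt_trans _ _ (fine J)).
  (* If a Gamma integral were infinite, its [fine] would be 0 and the bound would read 0 <= fine J;
     in the finite case it is [IJ]. *)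
  have J0 : 0 <= fine J by rewrite JE fineD// addr_ge0 ?fine_ge0.
  move: IJ J0 I10 I20; move: I1 I2 => [a| |] [b| |]//=; rewrite ?mulr0 ?mul0r//.
  by move=> <- _ _ _ /=; rewrite mulrC.
rewrite JE fineD// /euler_hyp2F1 expr1 mul1r mulNr !opprK ltrD2r.
by rewrite -lte_fin fineK.
Qed.

(** * Optimization *)

(** Convertible with [qstar] for A = C1 + C2, B = C3 + 1 and p the popularity of a file, so the
    optimization can be done with abstract constants. *)
Definition waterlevel (R : realType) (A B nu p : R) : R :=
  clip01 (Num.sqrt A / (Num.sqrt nu * B) * Num.sqrt p - A / B).

Lemma clip01_itv (R : realType) (x : R) : 0 <= clip01 x <= 1.
Proof. by rewrite /clip01 le_max lexx orbT/= ge_max ler01 ge_min lexx orbT. Qed.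

(* Strict concavity of q |-> p q / (A + B q) makes the clipped stationary point
   of the Lagrangian its unique maximizer on [0, 1]. *)
Lemma waterlevel_lagrangian (R : realType) (A B nu p q : R) :
  0 < A -> 0 < B -> 0 < nu -> 0 < p -> 0 <= q <= 1 -> q != waterlevel A B nu p ->
  p * q / (A + B * q) - nu * q <
  p * waterlevel A B nu p / (A + B * waterlevel A B nu p)
  - nu * waterlevel A B nu p.
Proof.
move=> A0 B0 nu0 p0 /andP[q0 q1].
have /andP[] := clip01_itv (Num.sqrt A / (Num.sqrt nu * B) * Num.sqrt p - A / B).
rewrite /waterlevel; set x := (X in clip01 X).
(* K is the value of A + B q at the unclipped stationary point x; there the derivative p A / (A + B
   q)^2 equals nu, which is [K2]. *)
pose K := Num.sqrt A * Num.sqrt p / Num.sqrt nu.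
have B_neq0 := lt0r_neq0 B0.
have sn : Num.sqrt nu != 0 by rewrite gt_eqF// sqrtr_gt0.
have K0 : 0 < K by rewrite /K !mulr_gt0 ?invr_gt0 ?sqrtr_gt0.
have KE : K = A + B * x by rewrite /K /x; field; rewrite B_neq0 sn.
have K2 : K ^+ 2 * nu = A * p.
  rewrite /K -{2}(sqr_sqrtr (ltW nu0)) -{2}(sqr_sqrtr (ltW A0)) -{2}(sqr_sqrtr (ltW p0)).
  by field.
set r := clip01 x => r0 r1 qr.
have Q0 : 0 < A + B * q by rewrite ltr_pwDl// mulr_ge0// ltW.
have R0 : 0 < A + B * r by rewrite ltr_pwDl// mulr_ge0// ltW.
(* Up to a positive factor this is the gap between the two Lagrangian values. The cases are x <= 0
   (r = 0, K <= A), 0 < x <= 1 (r = x) and x > 1 (r = 1, K > A + B). *)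
have key : 0 < (q - r) * ((A + B * q) * (A + B * r) - K ^+ 2).
  move: qr r0 r1 R0; rewrite /r /clip01; have [x1|x1] := leP x 1.
    have [x0|x0] := leP x 0.
      move=> qr _ _ _; have {}q0 : 0 < q by rewrite lt_neqAle eq_sym qr.
      have KA : K <= A by rewrite KE gerDl mulr_ge0_le0// ltW.
      have Bq : 0 < B * q by rewrite mulr_gt0.
      by rewrite subr0 mulr0 addr0 mulr_gt0//; nra.
    move=> qr _ _ _; rewrite -KE.
    have -> : (q - x) * ((A + B * q) * K - K ^+ 2) = K * B * (q - x) ^+ 2.
      by rewrite expr2 {2}KE; ring.
    by rewrite (mulr_gt0 (mulr_gt0 K0 B0))// exprn_even_gt0//= subr_eq0.
  rewrite max_l ?ler01// => qr _ _ _; have {}q1 : q < 1 by rewrite lt_neqAle qr.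
  have KA : A + B < K by rewrite KE -subr_gt0; have := ltr_pM2l B0 1 x; rewrite x1; lra.
  have Bq : B * q < B by rewrite -[ltRHS]mulr1 ltr_pM2l.
  rewrite mulr1 nmulr_rgt0; last lra.
  nra.
rewrite -subr_gt0.
have -> : p * r / (A + B * r) - nu * r - (p * q / (A + B * q) - nu * q)
    = nu * ((q - r) * ((A + B * q) * (A + B * r) - K ^+ 2))
      / ((A + B * q) * (A + B * r)).
  have -> : nu * ((q - r) * ((A + B * q) * (A + B * r) - K ^+ 2)) =
    (q - r) * (nu * ((A + B * q) * (A + B * r)) - K ^+ 2 * nu) by ring.
  by rewrite K2; field; rewrite !gt_eqF.
by apply: divr_gt0; exact: mulr_gt0.
Qed.

Lemma clip01_continuous (R : realType) : continuous (@clip01 R).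
Proof.
move=> x; apply: (@continuous_max R R (fun x => Num.min x 1) (cst 0)).
  by apply: (@continuous_min R R id (cst 1)); [exact: cvg_id|exact: cvg_cst].
exact: cvg_cst.
Qed.

Lemma waterlevel_sum_surj (R : realType) (A B : R) (n k : nat) (p : 'I_n -> R) :
  0 < A -> 0 < B -> (forall f, 0 < p f) -> (0 < k <= n)%N ->
  exists nu : R, 0 < nu /\ \sum_(f < n) waterlevel A B nu (p f) = k%:R.
Proof.
move=> A0 B0 p0 /andP[k0 kn].
pose a f := Num.sqrt A / B * Num.sqrt (p f).
have a0 f : 0 < a f by rewrite /a !mulr_gt0 ?invr_gt0 ?sqrtr_gt0.
(* T is the total cache use as a function of x = 1 / sqrt nu, in which it is continuous even at x =
   0. *)
pose T (x : R) := \sum_(f < n) clip01 (x * a f - A / B).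
have AB : 0 < A / B by rewrite divr_gt0.
(* Each summand is the level from which the entry of f is clipped to 1; their sum X exceeds all of
   these levels at once or equals them. *)
pose X := \sum_(f < n) ((1 + A / B) / a f).
have t0 f : 0 < (1 + A / B) / a f by rewrite divr_gt0// addr_gt0.
have X0 : 0 <= X by apply: sumr_ge0 => f _; exact: ltW.
have T0 : T 0 = 0.
  rewrite /T big1// => f _; rewrite mul0r sub0r /clip01 min_l; last lra.
  by rewrite max_r; lra.
have TX : T X = n%:R.
  rewrite /T (eq_bigr (fun=> 1)); last first.
    move=> f _; have Xf : (1 + A / B) / a f <= X.
      by rewrite /X (bigD1 f)//= lerDl sumr_ge0// => i _; exact: ltW.
    have : 1 + A / B <= X * a f by rewrite -ler_pdivrMr.
    by move=> h; rewrite /clip01 min_r ?max_l//; lra.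
  by rewrite sumr_const card_ord.
have cT : continuous T.
  move=> x; apply: cvg_big => [|f _]; first exact: add_continuous.
  apply: (cvg_comp (fun x => x * a f - A / B) (@clip01 R)); last exact: clip01_continuous.
  by apply: cvgB; [apply: cvgMr_tmp; exact: cvg_id|exact: cvg_cst].
have [|x] := IVT (v := k%:R) X0 (continuous_subspaceT cT).
  by rewrite T0 TX min_l ?max_r ?ler0n// ler_nat.
rewrite in_itv/= => /andP[x_ge0 _] Tx.
have x0 : 0 < x.
  rewrite lt_neqAle x_ge0 andbT; apply/eqP => x0; move: Tx; rewrite -x0 T0.
  by move=> /esym/eqP; rewrite pnatr_eq0 gtn_eqF.
exists (x ^- 2); split; first by rewrite invr_gt0 exprn_gt0.
rewrite -Tx; apply: eq_bigr => f _; rewrite /waterlevel /a.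
rewrite -exprVn sqrtr_sqr ger0_norm ?invr_ge0//.
congr (clip01 (_ - _)); field.
by rewrite !gt_eqF.
Qed.

(** * The offloading probability *)

Lemma popularity_gt0 (R : realType) (S : params R) (Nf : nat) (f : 'I_Nf) :
  0 < popularity S f.
Proof.
rewrite /popularity divr_gt0 ?powR_gt0// big_ltn ?ltnS ?(leq_ltn_trans _ (ltn_ord f))//.
by rewrite ltr_pwDl ?powR_gt0// sumr_ge0// => n _; exact: powR_ge0.
Qed.

Lemma Gamma_ge0 (R : realType) (x : R) : 0 <= Gamma x.
Proof. by apply: Rintegral_ge0 => t _; rewrite mulr_ge0 ?powR_ge0 ?expR_ge0. Qed.

Lemma C2_ge0 (R : realType) (S : params R) : 0 <= C2 S.
Proof.
by rewrite /C2 mulr_ge0 ?powR_ge0// divr_ge0 ?Gamma_ge0// mulr_ge0 ?Gamma_ge0.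
Qed.

Lemma C1_gt0 (R : realType) (S : params R) (lam1 lam2 : R) :
  0 < lam1 -> 0 < lam2 -> 0 < P12 S * B12 S -> 0 < B12 S -> 0 < gamma0 S ->
  2 < alpha S -> (0 < M1 S)%N -> 0 < C1 S lam1 lam2.
Proof.
move=> l1 l2 PB B g a M; rewrite /C1 mulr_gt0//.
  by rewrite mulr_gt0 ?powR_gt0 ?divr_gt0.
apply: hyp2F1_gt0 => //; first by rewrite ltr_pdivrMr; lra.
by rewrite oppr_le0 divr_ge0 ?(ltW g)// mulr_ge0 ?(ltW B)// divr_ge0.
Qed.

(** With M2 = 1 and Gamma 1 = 1, C2 becomes the product bounded in [Gamma_product_lt], and C3 + 1 is
    the gap in that inequality. *)
Lemma C3_gtN1 (R : realType) (S : params R) :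
  0 < gamma0 S -> 2 < alpha S -> M2 S = 1%N -> 0 < C3 S + 1.
Proof.
move=> g a M21; have a0 : 0 < alpha S by lra.
have s01 : 0 < 2 / alpha S < 1 by rewrite divr_gt0//= ltr_pdivrMr//; lra.
rewrite /C3 /C2 M21 hyp2F1_euler; last 2 first.
- by case/andP: s01.
- by lra.
by rewrite Gamma1 divr1 subrK subr_gt0; exact: Gamma_product_lt.
Qed.

(** The densities enter only through l1 / l2 and lu / l2. A nonzero q makes the sum [sigma]
    positive, so the base of the power tends to +oo; for q = 0, [pa2] is constantly 0. *)
Lemma pa2_cvg1 (R : realType) (S : params R) (lam1 lam2 : R) (Nf : nat)
    (T : Type) (F : set_system T) (FF : Filter F) (l1 l2 lu : T -> R)
    (q : 'I_Nf -> R) :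
  0 < lam1 / lam2 -> 0 < P12 S * B12 S ->
  (forall t, l1 t / l2 t = lam1 / lam2) ->
  lu t / l2 t @[t --> F] --> +oo ->
  caching_vector q -> (exists f, q f != 0) ->
  pa2 S (l1 t) (l2 t) (lu t) q @[t --> F] --> (1 : R).
Proof.
move=> lam0 PB l12 lu2 q01 [f0 qf0].
pose c := lam1 / lam2 * (P12 S * B12 S) `^ (2 / alpha S).
have c0 : 0 < c by rewrite mulr_gt0 ?powR_gt0.
pose sigma := \sum_(f < Nf) (popularity S f * q f / (c + q f)).
have q0 f : 0 <= q f by have /andP[] := q01 f.
have sigma0 : 0 < sigma.
  rewrite /sigma (bigD1 f0)//= ltr_pwDl//.
    have qf : 0 < q f0 by rewrite lt0r qf0 q0.
    by apply: divr_gt0; [apply: mulr_gt0 => //; exact: popularity_gt0|exact: addr_gt0].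
  apply: sumr_ge0 => f _.
  apply: divr_ge0; last by rewrite addr_ge0 ?(ltW c0).
  by apply: mulr_ge0 => //; exact/ltW/popularity_gt0.
have -> : (fun t => pa2 S (l1 t) (l2 t) (lu t) q) =
    (fun t => 1 - (1 + 2 / 7 * sigma * (lu t / l2 t)) `^ (- (7 / 2))).
  apply/funext => t; rewrite /pa2 l12 -/c -/sigma.
  by congr (1 - (1 + _) `^ _); rewrite invfM invf_div; ring.
rewrite -[X in _ --> X]subr0; apply: cvgB; first exact: cvg_cst.
apply: (cvg_comp (fun t => 1 + 2 / 7 * sigma * (lu t / l2 t))
  (fun x => x `^ (- (7 / 2)))); last by apply: powRN_cvgy; lra.
have k0 : 0 < 2 / 7 * sigma by rewrite mulr_gt0//; lra.
apply/cvgryPge => A; move/cvgryPge : lu2 => /(_ ((A - 1) / (2 / 7 * sigma))).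
apply: filterS => t; rewrite ler_pdivrMr// => h.
by rewrite -lerBlDl mulrC.
Qed.

Lemma Poff_cvg (R : realType) (S : params R) (lam1 lam2 : R) (Nf : nat)
    (T : Type) (F : set_system T) (FF : Filter F) (l1 l2 lu : T -> R)
    (q : 'I_Nf -> R) :
  0 < C1 S lam1 lam2 + C2 S -> 0 < C3 S + 1 ->
  (forall t, l1 t / l2 t = lam1 / lam2) -> caching_vector q ->
  pa2 S (l1 t) (l2 t) (lu t) q @[t --> F] --> (1 : R) ->
  Poff S (l1 t) (l2 t) (lu t) q @[t --> F] --> Poff_inf S lam1 lam2 q.
Proof.
move=> A0 B0 l12 q01 pa1.
have C1E t : C1 S (l1 t) (l2 t) = C1 S lam1 lam2 by rewrite /C1 l12.
rewrite /Poff /Poff_inf; apply: cvg_big => [|f _]; first exact: add_continuous.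
have /andP[q0 _] := q01 f.
apply: cvgMl_tmp; apply: cvgV.
  by rewrite gt_eqF// ltr_pwDl// mulr_ge0// ltW.
have -> : C1 S lam1 lam2 + C2 S + (C3 S + 1) * q f =
  C1 S lam1 lam2 + C2 S * 1 + C3 S * 1 * q f + q f by ring.
apply: cvgD; last exact: cvg_cst.
apply: cvgD; last by apply: cvgMr_tmp; apply: cvgMl_tmp.
apply: cvgD; last exact: cvgMl_tmp.
by under eq_cvg do rewrite C1E; exact: cvg_cst.
Qed.

(** Handles the zero vector, for which [pa2] does not tend to 1 but the limit of [Poff] still
    holds. *)
Lemma Poff_eq0 (R : realType) (S : params R) (lam1 lam2 lamu : R) (Nf : nat)
    (q : 'I_Nf -> R) :
  (forall f, q f = 0) ->
  Poff S lam1 lam2 lamu q = 0 /\ Poff_inf S lam1 lam2 q = 0.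
Proof.
by move=> q0; split; rewrite /Poff /Poff_inf big1// => f _; rewrite q0 mulr0 mul0r.
Qed.

(** Sum the Lagrangian inequalities over the files, strict at a file where q differs; the budget
    inequality, multiplied by nu, then removes the linear terms. *)
Lemma waterlevel_maximizer (R : realType) (A B nu : R) (n : nat)
    (p q : 'I_n -> R) :
  0 < A -> 0 < B -> 0 < nu -> (forall f, 0 < p f) ->
  \sum_f q f <= \sum_f waterlevel A B nu (p f) -> caching_vector q ->
  q <> (fun f => waterlevel A B nu (p f)) ->
  \sum_f (p f * q f / (A + B * q f)) <
  \sum_f (p f * waterlevel A B nu (p f) / (A + B * waterlevel A B nu (p f))).
Proof.
move=> A0 B0 nu0 p0 qs q01 qne; set r := fun f => waterlevel A B nu (p f).
have [f0 qf0] : exists f, q f != r f.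
  apply/existsP; apply: contraT; rewrite negb_exists => /forallP h.
  by case: qne; apply/funext => f; apply/eqP; have := h f; rewrite negbK.
pose phi (x : 'I_n -> R) f := p f * x f / (A + B * x f) - nu * x f.
have lt_phi f : q f != r f -> phi q f < phi r f.
  by move=> qf; apply: waterlevel_lagrangian.
have le_phi f : phi q f <= phi r f.
  by have [qf|/lt_phi/ltW//] := eqVneq (q f) (r f); rewrite /phi qf.
have : \sum_f phi q f < \sum_f phi r f.
  rewrite (bigD1 f0)//= [ltRHS](bigD1 f0)//= ltr_leD ?lt_phi//.
  by apply: ler_sum => f _.
rewrite !sumrB -!mulr_sumr => lt_sum.
have le_nu : nu * \sum_f q f <= nu * \sum_f r f by rewrite ler_pM2l.
lra.
Qed.

(** The regime is an arbitrary filter along which lu / l2 tends to +oo while l1 / l2 stays equal to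
    lam1 / lam2, so sequences and continuous parameters are both covered. *)
Theorem proposition2 (R : realType) (S : params R) (lam1 lam2 : R)
    (Nf Nc : nat)
    (lam1_gt0 : 0 < lam1) (lam2_gt0 : 0 < lam2)
    (P1_gt0 : 0 < P1 S) (P2_gt0 : 0 < P2 S)
    (B1_gt0 : 0 < B1 S) (B2_gt0 : 0 < B2 S)
    (gamma0_gt0 : 0 < gamma0 S) (alpha_gt2 : 2 < alpha S)
    (delta_gt0 : 0 < delta S)
    (M1_ge1 : (1 <= M1 S)%N) (M2_eq1 : M2 S = 1%N)
    (Nc_ge1 : (1 <= Nc)%N) (Nc_leNf : (Nc <= Nf)%N) :
  (forall (T : Type) (F : set_system T) (FF : Filter F) (l1 l2 lu : T -> R),
     (forall t, [/\ 0 < l1 t, 0 < l2 t & 0 < lu t]) ->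
     (forall t, l1 t / l2 t = lam1 / lam2) ->
     lu t / l2 t @[t --> F] --> +oo ->
     forall q : 'I_Nf -> R, caching_vector q ->
       ((exists f, q f != 0) ->
          pa2 S (l1 t) (l2 t) (lu t) q @[t --> F] --> (1 : R)) /\
       Poff S (l1 t) (l2 t) (lu t) q @[t --> F] --> Poff_inf S lam1 lam2 q) /\
  (exists nu : R, 0 < nu /\
     \sum_(f < Nf) qstar S lam1 lam2 nu f = Nc%:R) /\
  (forall nu : R, 0 < nu ->
     \sum_(f < Nf) qstar S lam1 lam2 nu f = Nc%:R ->
     is_the_maximizer (@feasible R Nf Nc) (@Poff_inf R S lam1 lam2 Nf)
       (fun f => qstar S lam1 lam2 nu f)).
Proof.
have a0 : 0 < alpha S by lra.
have lam0 : 0 < lam1 / lam2 by exact: divr_gt0.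
have B0 : 0 < B12 S by exact: divr_gt0.
have PB0 : 0 < P12 S * B12 S by rewrite mulr_gt0// divr_gt0.
have A_gt0 : 0 < C1 S lam1 lam2 + C2 S.
  by rewrite ltr_pwDl ?C2_ge0//; exact: C1_gt0.
have C3_gt0 : 0 < C3 S + 1 by exact: C3_gtN1.
split; [|split].
- move=> T F FF l1 l2 lu _ l12 lu2 q q01.
  have pa1 := @pa2_cvg1 _ S lam1 lam2 _ _ _ FF l1 l2 lu q lam0 PB0 l12 lu2 q01.
  split => //; have [q_neq0|q_eq0] := pselect (exists f, q f != 0).
    by apply: Poff_cvg => //; exact: pa1.
  have q0 f : q f = 0 by apply/eqP/negPn/negP => qf; apply: q_eq0; exists f.
  under eq_cvg do rewrite (Poff_eq0 _ _ _ _ q0).1.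
  by rewrite (Poff_eq0 S lam1 lam2 0 q0).2; exact: cvg_cst.
(* Unification unfolds [qstar] to [waterlevel] here and in the maximality claim below. *)
- by apply: waterlevel_sum_surj => //; [exact: popularity_gt0|rewrite Nc_ge1].
move=> nu nu_gt0 sum_nu; split.
  by split; [rewrite sum_nu|move=> f; exact: clip01_itv].
move=> q [qs q01] qne; apply: waterlevel_maximizer => //.
  exact: popularity_gt0.
by rewrite sum_nu.
Qed.
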